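(* Let $(\varphi_n,\mu_n)_{n}$ be any sequence of Whitham solutions in $S$. Then it has a subsequence along which $\mu_n$ converges to some $\mu$ and $\varphi_n$ converges uniformly to a solution $\varphi$ of $-\mu\varphi+\varphi^2+K*\varphi=0$, with $\varphi\in C^\alpha(\mathbb{S})$ for arbitrary $\alpha\in(0,\frac12)$. At any point where $\varphi<\frac{\mu}{2}$ the solution $\varphi$ is $\alpha$-Hölder continuous for all $\alpha\in(0,1)$.
   Context: $\mathbb{S}$ is the unit circle; functions on $\mathbb{S}$ are identified with $2\pi$-periodic functions on $\mathbb{R}$. For $\beta\in(0,1)$, $C^\beta(\mathbb{S})$ is the space of $\beta$-Hölder continuous functions on $\mathbb{S}$, and $C^\beta_{\mathrm{even}}(\mathbb{S})$ its subspace of real-valued even functions. The Whitham kernel $K\in L^1(\mathbb{R})$ is the inverse Fourier transform of $\xi\mapsto(\tanh(\xi)/\xi)^{1/2}$ (value $1$ at $\xi=0$), where the Fourier transform is $\int f(x)e^{-ix\xi}\,dx$. On even $2\pi$-periodic functions, convolution with $K$ acts as $\sum_{k\ge0}a_k\cos(kx)\mapsto\sum_{k\ge 0}a_k(\tanh(k)/k)^{1/2}\cos(kx)$, the factor for $k=0$ being $1$. Fix $\alpha_0\in(\frac12,1)$. $S$ is the set of pairs $(\varphi,\mu)\in C^{\alpha_0}_{\mathrm{even}}(\mathbb{S})\times(0,1)$ with $\varphi<\mu/2$ and $-\mu\varphi+\varphi^2+K*\varphi=0$ (Whitham solutions). *)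

(* Defs.v *)
From HB Require Import structures.
From mathcomp Require Import all_boot all_order all_algebra.
From mathcomp Require Import all_classical all_reals all_analysis.
From mathcomp Require Export complex.
Import Order.TTheory GRing.Theory Num.Theory.
Import numFieldNormedType.Exports.

Set Implicit Arguments.
Unset Strict Implicit.
Unset Printing Implicit Defensive.

Local Open Scope classical_set_scope.
Local Open Scope ring_scope.

Section Defs.
Context {R : realType}.
Implicit Types (f K phi : R -> R) (A : set R) (alpha mu : R).

Definition holder_on alpha A f :=
  exists C : R, forall x y, A x -> A y -> `|f x - f y| <= C * `|x - y| `^ alpha.

(* For a 2pi-periodic function, holder_on setT with the distance of the line
   amounts to the Hölder condition with the arc-length distance of the circle,
   since the latter is the minimum of the former over all lifts. *)
Definition C_circle alpha : set (R -> R) :=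
  [set f | periodic f (pi *+ 2) /\ holder_on alpha setT f].

Definition C_circle_even alpha : set (R -> R) :=
  [set f | C_circle alpha f /\ forall x, f (- x) = f x].

Definition holder_near alpha f (x : R) :=
  exists2 U : set R, nbhs x U & holder_on alpha U f.

Definition tanh (x : R) : R :=
  (expR x - expR (- x)) / (expR x + expR (- x)).

Definition whitham_symbol (xi : R) : R :=
  if xi == 0 then 1 else Num.sqrt (tanh xi / xi).

(* The integral of f(x) e^{-i x xi}, split into real and imaginary parts. *)
Definition fourier f (xi : R) : R[i] :=
  Complex (\int[lebesgue_measure]_x (f x * cos (x * xi)))
          (- \int[lebesgue_measure]_x (f x * sin (x * xi))).

(* These conditions determine K almost everywhere.  Taking K real-valued is no
   restriction, as the symbol is real and even. *)
Definition is_whitham_kernel K :=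
  lebesgue_measure.-integrable setT (EFin \o K) /\
  forall xi, fourier K xi = (whitham_symbol xi)%:C%C.

Definition convolution K phi (x : R) : R :=
  \int[lebesgue_measure]_y (K (x - y) * phi y).

Definition whitham_eq K mu phi :=
  forall x, - mu * phi x + phi x ^+ 2 + convolution K phi x = 0.

Definition whitham_solutions K alpha0 : set ((R -> R) * R) :=
  [set u | [/\ C_circle_even alpha0 u.1, 0 < u.2 < 1,
               forall x, u.1 x < u.2 / 2 & whitham_eq K u.2 u.1]].

End Defs.

(* Main.v *)
Require Import Defs.
From HB Require Import structures.
From mathcomp Require Import all_boot all_order all_algebra.
From mathcomp Require Import all_classical all_reals all_analysis.
From mathcomp Require Import measurable_realfun.
From mathcomp Require Import ring lra zify.
Import Order.TTheory GRing.Theory Num.Theory.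
Import numFieldNormedType.Exports.

(** Write [L] for the convolution with [K] and [m k] for its symbol at the
    integer [k].  Completing the square, the equation reads
    [(mu/2 - phi)^2 = mu^2/4 - L phi]; since [mu/2 - phi] is positive, this
    gives [|phi x - phi y|^2 <= |L phi x - L phi y|].  The operator [L] gains
    half a derivative; the form used here is that it maps [C^al] to [C^(2 al)]
    for [al < 1/2] ([convolution_holder]).  Hence the best Hölder constant [H]
    of a solution satisfies [H^2 <= C H], that is [H <= C], with [C]
    independent of the solution ([whitham_solution_holder]).  That [H] is
    finite to begin with comes from [alpha0 > 1/2].  The same argument with
    the supremum of [|phi|] in place of [H] bounds the solutions uniformly
    ([whitham_solution_bounded]).  Equicontinuity then yields a uniformly
    convergent subsequence ([uniform_subsequence]), and the equation and the
    estimates pass to the limit.  Where the limit is below [mu/2] the square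
    root is locally Lipschitz, so that [phi] is there as regular as [L phi],
    which is [C^(2 al)] for every [al < 1/2].

    The smoothing property uses only the values of the symbol at the integers.
    On trigonometric polynomials [L] multiplies the frequency [k] by [m k], and
    summing by parts twice writes it as the superposition of the Fejér means
    of order [n] with weights [(n+1) (m n - 2 m (n+1) + m (n+2))]
    ([convolution_trig]).  As [m k] is [k^(-1/2)] up to an exponentially small
    error, these weights are of order [n^(-3/2)].  Over a step [h], the Fejér
    mean of order [n] of a function with Hölder constant [H] varies by at most
    a multiple of [H h^(2 al) n^al] ([fejer_mean_holder]): for [h >= 1/n]
    because the Fejér kernel is a probability density, for [h < 1/n] by
    Bernstein's inequality.  The resulting series converges exactly when
    [al < 1/2].  Every periodic Hölder function is a uniform limit of
    trigonometric polynomials ([trig_poly_dense]), and [L] is bounded for the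
    supremum norm.

    Averages over the circle are taken over [M] equidistant nodes, with [M]
    larger than the frequencies involved.  They are then exact on
    trigonometric polynomials, and the convolution with [K] is the only
    integral of the proof. *)

Local Open Scope classical_set_scope.
Local Open Scope ring_scope.

(** * Trigonometric polynomials and averages over equidistant nodes *)

Section TrigPoly.
Set Implicit Arguments. Unset Strict Implicit. Unset Printing Implicit Defensive.
Context {R : realType}.
Implicit Types (f g S T : R -> R) (D M : nat).

(** [trig_poly D T]: [T] is a real trigonometric polynomial with all
    frequencies below [D].  The phase [c] replaces the sine terms and makes
    stability under translation and reflection immediate. *)
Inductive trig_poly D : (R -> R) -> Prop :=
| trig_poly_cos k c : (k < D)%N -> trig_poly D (fun x => cos (k%:R * x + c))
| trig_poly0 : trig_poly D (fun=> 0)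
| trig_polyD S T : trig_poly D S -> trig_poly D T ->
    trig_poly D (fun x => S x + T x)
| trig_polyZ a T : trig_poly D T -> trig_poly D (fun x => a * T x).

Lemma eq_trig_poly D S T : S =1 T -> trig_poly D S -> trig_poly D T.
Proof. by move=> /funext ->. Qed.

Lemma trig_poly_sum D n (F : nat -> R -> R) :
  (forall i, (i < n)%N -> trig_poly D (F i)) ->
  trig_poly D (fun x => \sum_(i < n) F i x).
Proof.
elim: n => [_|n IHn HF].
  by apply: eq_trig_poly (trig_poly0 D) => x; rewrite big_ord0.
have HFn i : (i < n)%N -> trig_poly D (F i) by move=> /ltnW; exact: HF.
apply: eq_trig_poly (trig_polyD (IHn HFn) (HF n (ltnSn n))) => x.
by rewrite big_ord_recr.
Qed.

Lemma trig_poly_shift D T c : trig_poly D T -> trig_poly D (fun x => T (x + c)).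
Proof.
elim=> [k d kD||S' T' _ hS _ hT|a T' _ hT].
- apply: eq_trig_poly (trig_poly_cos (k%:R * c + d) kD) => x.
  by rewrite mulrDr addrA.
- exact: trig_poly0.
- exact: trig_polyD.
- exact: trig_polyZ.
Qed.

Lemma trig_poly_reflect D T c :
  trig_poly D T -> trig_poly D (fun x => T (c - x)).
Proof.
elim=> [k d kD||S' T' _ hS _ hT|a T' _ hT].
- apply: eq_trig_poly (trig_poly_cos (- (k%:R * c + d)) kD) => x.
  by rewrite -cosN; congr cos; ring.
- exact: trig_poly0.
- exact: trig_polyD.
- exact: trig_polyZ.
Qed.

Lemma trig_poly_cos_diff D (i l : nat) c : (i < D)%N -> (l < D)%N ->
  trig_poly D (fun x => cos ((i%:R - l%:R) * x + c)).
Proof.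
move=> iD lD; have [il|li] := leqP l i.
  have kD : (i - l < D)%N by lia.
  by apply: eq_trig_poly (trig_poly_cos c kD) => x; rewrite natrB.
have kD : (l - i < D)%N by lia.
apply: eq_trig_poly (trig_poly_cos (- c) kD) => x.
by rewrite -cosN natrB 1?ltnW//; congr cos; ring.
Qed.

Lemma mul_cos (a b : R) : cos a * cos b = 2^-1 * (cos (a + b) + cos (a - b)).
Proof. by rewrite cosD cosB; field. Qed.

Lemma trig_polyM D1 D2 S T : trig_poly D1 S -> trig_poly D2 T ->
  trig_poly (D1 + D2) (fun x => S x * T x).
Proof.
move=> hS hT; elim: hS => [k d kD||S1 S2 _ h1 _ h2|a S' _ h].
- elim: hT => [l e lD||T1 T2 _ h1 _ h2|a T' _ h].
  + have H1 : (k + l < D1 + D2)%N by lia.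
    have H2 : (k < D1 + D2)%N by lia.
    have H3 : (l < D1 + D2)%N by lia.
    apply: eq_trig_poly (trig_polyZ 2^-1 (trig_polyD
      (trig_poly_cos (d + e) H1) (trig_poly_cos_diff (d - e) H2 H3))) => x /=.
    by rewrite mul_cos natrD; congr (_ * (cos _ + cos _)); ring.
  + by apply: eq_trig_poly (trig_poly0 _) => x; rewrite mulr0.
  + by apply: eq_trig_poly (trig_polyD h1 h2) => x /=; rewrite mulrDr.
  + by apply: eq_trig_poly (trig_polyZ a h) => x /=; rewrite mulrCA.
- by apply: eq_trig_poly (trig_poly0 _) => x; rewrite mul0r.
- by apply: eq_trig_poly (trig_polyD h1 h2) => x /=; rewrite mulrDl.
- by apply: eq_trig_poly (trig_polyZ a h) => x /=; rewrite mulrA.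
Qed.

Lemma trig_poly_bounded D T : trig_poly D T ->
  exists B, forall x, `|T x| <= B.
Proof.
elim=> [k c _||S' T' _ [B hB] _ [C hC]|a T' _ [B hB]].
- by exists 1 => x; exact: cos_max.
- by exists 0 => x; rewrite normr0.
- by exists (B + C) => x; rewrite (le_trans (ler_normD _ _))// lerD.
- by exists (`|a| * B) => x; rewrite normrM ler_wpM2l.
Qed.

Lemma trig_poly_continuous D T : trig_poly D T -> continuous T.
Proof.
elim=> [k c _ x||S' T' _ hS _ hT x|a T' _ hT x].
- apply: (@continuous_comp R R R (fun y => k%:R * y + c) cos x).
    apply: cvgD; last exact: cvg_cst.
    by apply: cvgM; [exact: cvg_cst|exact: cvg_id].
  exact: continuous_cos.
- by move=> x; exact: cvg_cst.
- by apply: cvgD; [exact: hS|exact: hT].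
- by apply: cvgM; [exact: cvg_cst|exact: hT].
Qed.

(** The average of [g] over the [M]-th roots of unity. *)
Definition mean M g := (\sum_(j < M) g (pi *+ 2 * (j%:R / M%:R))) / M%:R.

Lemma meanD M f g : mean M (fun y => f y + g y) = mean M f + mean M g.
Proof. by rewrite /mean big_split mulrDl. Qed.

Lemma meanZ M a f : mean M (fun y => a * f y) = a * mean M f.
Proof. by rewrite /mean -big_distrr/= mulrA. Qed.

Lemma mean_sum M n (F : nat -> R -> R) :
  mean M (fun y => \sum_(i < n) F i y) = \sum_(i < n) mean M (F i).
Proof. by rewrite /mean exchange_big/= big_distrl. Qed.

Lemma mean0 M : mean M (fun=> 0) = 0.
Proof. by rewrite /mean big1// mul0r. Qed.

Lemma mean_cst M a : (0 < M)%N -> mean M (fun=> a) = a.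
Proof.
move=> M0; rewrite /mean sumr_const card_ord -[a *+ M]mulr_natr mulfK//.
by rewrite pnatr_eq0 -lt0n.
Qed.

Lemma eq_mean M f g : f =1 g -> mean M f = mean M g.
Proof. by move=> /funext ->. Qed.

Lemma ler_mean M f g : (forall x, f x <= g x) -> mean M f <= mean M g.
Proof. by move=> fg; rewrite /mean ler_wpM2r ?invr_ge0// ler_sum. Qed.

Lemma ler_norm_mean M f : `|mean M f| <= mean M (fun y => `|f y|).
Proof.
rewrite /mean normrM normfV [`|M%:R|]ger0_norm// ler_wpM2r ?invr_ge0//.
exact: ler_norm_sum.
Qed.

(** Multiplied by [2 sin (a / 2)], where [a] is the increment of the phase from
    one node to the next, the sum telescopes over a whole number of periods;
    the bound [k < M] is what makes this factor nonzero. *)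
Lemma mean_cos M k c : (0 < k < M)%N ->
  mean M (fun y => cos (k%:R * y + c)) = 0.
Proof.
move=> /andP[k0 kM].
have M0 : (M%:R : R) != 0 by rewrite pnatr_eq0; lia.
pose a : R := k%:R * (pi *+ 2) / M%:R.
pose F j : R := sin (a * j%:R - a / 2 + c).
have sa : 2 * sin (a / 2) != 0.
  rewrite mulf_neq0// lt0r_neq0//; apply: sin_gt0_pi.
  have -> : a / 2 = pi * (k%:R / M%:R) by rewrite /a; field.
  rewrite mulr_gt0 ?pi_gt0 ?divr_gt0 ?ltr0n//=; last lia.
  rewrite gtr_pMr ?pi_gt0// ltr_pdivrMr ?mul1r ?ltr_nat ?ltr0n//; lia.
apply/eqP; rewrite /mean mulf_eq0; apply/orP; left.
rewrite -(mulrI_eq0 _ (mulfI sa)) big_distrr/= -(big_mkord xpredT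
  (fun j => 2 * sin (a / 2) * cos (k%:R * (pi *+ 2 * (j%:R / M%:R)) + c))).
rewrite (eq_bigr (fun j => F j.+1 - F j)) => [|j _].
  rewrite telescope_sumr// /F subr_eq0 mulr0.
  have -> : a * M%:R - a / 2 + c = (0 - a / 2 + c) + (pi *+ 2) *+ k.
    by rewrite -[_ *+ k]mulr_natl /a; field.
  by rewrite periodicn//; exact: sinD2pi.
have -> : k%:R * (pi *+ 2 * (j%:R / M%:R)) + c = a * j%:R + c.
  by rewrite /a; field.
have -> : F j.+1 = sin (a * j%:R + c + a / 2).
  by rewrite /F -natr1; congr sin; field.
have -> : F j = sin (a * j%:R + c - a / 2) by congr sin; ring.
by rewrite sinD sinB; ring.
Qed.

Lemma mean_cos_diff M (i l : nat) c : (i < M)%N -> (l < M)%N ->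
  mean M (fun y => cos ((i%:R - l%:R) * y + c)) = (i == l)%:R * cos c.
Proof.
move=> iM lM; case: (ltngtP l i) => il.
- rewrite mul0r -[RHS](@mean_cos M (i - l) c); last lia.
  by apply: eq_mean => y; rewrite natrB// ltnW.
- rewrite mul0r -[RHS](@mean_cos M (l - i) (- c)); last lia.
  apply: eq_mean => y; rewrite natrB 1?ltnW// -cosN; congr cos; ring.
- rewrite il mul1r -[RHS](@mean_cst M (cos c)); last lia.
  by apply: eq_mean => y; rewrite subrr mul0r add0r.
Qed.

(** No nonzero frequency below [M] is aliased to zero by the nodes: the average
    of such a polynomial is its constant coefficient, which a reflection does
    not change although it moves the nodes. *)
Lemma mean_trig_reflect M T c : trig_poly M T ->
  mean M (fun y => T (c - y)) = mean M T.
Proof.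
elim=> [k d kM||S' T' _ hS _ hT|a T' _ hT].
- case: k kM => [|k] kM.
    by apply: eq_mean => y; rewrite !mul0r.
  rewrite mean_cos// -[RHS](@mean_cos M k.+1 (- (k.+1%:R * c + d)))//.
  by apply: eq_mean => y; rewrite -cosN; congr cos; ring.
- by [].
- by rewrite (meanD M (fun y => S' (c - y))) hS hT meanD.
- by rewrite (meanZ M a (fun y => T' (c - y))) hT meanZ.
Qed.

End TrigPoly.

(** * The Fejér kernel and Fejér means *)

Section Fejer.
Set Implicit Arguments. Unset Strict Implicit. Unset Printing Implicit Defensive.
Context {R : realType}.
Implicit Types (f g S T : R -> R) (D M n k : nat).

Lemma ler_norm_sin (x : R) : `|sin x| <= `|x|.
Proof.
wlog x0 : x / 0 < x => [hwlog|].
  case: (ltgtP x 0) => [xn|xp|->]; last by rewrite sin0.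
  - by rewrite -normrN -sinN -[leRHS]normrN hwlog// oppr_gt0.
  - exact: hwlog.
have [c _] := MVT x0 (fun y _ => @is_derive_sin R y)
  (continuous_subspaceT (@continuous_sin R)).
by rewrite sin0 !subr0 => ->; rewrite normrM ler_piMl// cos_max.
Qed.

Lemma ler_sum_cst n (F : 'I_n -> R) B :
  (forall i, F i <= B) -> \sum_i F i <= n%:R * B.
Proof.
move=> FB; apply: (@le_trans _ _ (\sum_(i < n) B)); first exact: ler_sum.
by rewrite sumr_const card_ord mulr_natl.
Qed.

(** The squared modulus of the complex polynomial [sum_i c_i e^(i u)]; this
    form makes its positivity evident. *)
Definition energy n (c : nat -> R) (u : R) :=
  (\sum_(i < n.+1) c i * cos (i%:R * u)) ^+ 2 +
  (\sum_(i < n.+1) c i * sin (i%:R * u)) ^+ 2.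

Lemma energyE n c u : energy n c u =
  \sum_(i < n.+1) \sum_(l < n.+1) c i * c l * cos ((i%:R - l%:R) * u).
Proof.
rewrite /energy !expr2 !big_distrlr/= -big_split; apply: eq_bigr => i _.
rewrite -big_split; apply: eq_bigr => l _ /=.
by rewrite mulrBl cosB; ring.
Qed.

Lemma energy_ge0 n c u : 0 <= energy n c u.
Proof. by rewrite addr_ge0 ?sqr_ge0. Qed.

(** Parseval's identity; it is exact for node averages as soon as [n < M]. *)
Lemma mean_energy n M c a : (n < M)%N ->
  mean M (fun y => energy n c (a - y)) = \sum_(i < n.+1) c i ^+ 2.
Proof.
move=> nM; rewrite (eq_mean M (fun y => energyE n c (a - y))).
rewrite (mean_sum M n.+1 (fun i y =>
  \sum_(l < n.+1) c i * c l * cos ((i%:R - l%:R) * (a - y)))).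
apply: eq_bigr => i _.
rewrite (mean_sum M n.+1 (fun l y => c i * c l * cos ((i%:R - l%:R) * (a - y)))).
have E (l : 'I_n.+1) :
    mean M (fun y => c i * c l * cos ((i%:R - l%:R) * (a - y))) =
    c i * c l * (l == i :> nat)%:R.
  rewrite meanZ (@eq_mean _ M _ (fun y =>
    cos ((l%:R - i%:R) * y + (i%:R - l%:R) * a))); last first.
    by move=> y; congr cos; ring.
  rewrite mean_cos_diff; [|have := ltn_ord l; lia|have := ltn_ord i; lia].
  by case: eqP => [->|_]; rewrite ?subrr ?mul0r ?cos0 ?mulr1.
rewrite (eq_bigr _ (fun l _ => E l)) (bigD1 i)//= eqxx mulr1 big1 ?addr0//.
by move=> l li; rewrite (negbTE (_ : l != i :> nat)) ?mulr0.
Qed.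

Definition fejer n (u : R) := energy n (fun=> 1) u / n.+1%:R.

Lemma fejer_ge0 n u : 0 <= fejer n u.
Proof. by rewrite divr_ge0 ?energy_ge0. Qed.

Lemma fejerE n u : fejer n u =
  n.+1%:R^-1 * \sum_(i < n.+1) \sum_(l < n.+1) cos ((i%:R - l%:R) * u).
Proof.
rewrite /fejer energyE mulrC; congr (_ * _).
by apply: eq_bigr => i _; apply: eq_bigr => l _; rewrite !mul1r.
Qed.

Lemma trig_poly_fejer n : trig_poly n.+1 (fejer n).
Proof.
apply: (eq_trig_poly (fun u => esym (fejerE n u))); apply: trig_polyZ.
apply: (@trig_poly_sum _ _ _ (fun i u =>
  \sum_(l < n.+1) cos ((i%:R - l%:R) * u))) => i ni.
apply: (@trig_poly_sum _ _ _ (fun l u => cos ((i%:R - l%:R) * u))) => l nl.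
by apply: eq_trig_poly (trig_poly_cos_diff 0 ni nl) => x; rewrite addr0.
Qed.

Lemma mean_fejer n M a : (n < M)%N -> mean M (fun y => fejer n (a - y)) = 1.
Proof.
move=> nM; rewrite (@eq_mean _ M _ (fun y =>
  n.+1%:R^-1 * energy n (fun=> 1) (a - y))); last by move=> y; rewrite mulrC.
rewrite meanZ mean_energy// (eq_bigr (fun=> 1)) => [|i _]; last exact: expr1n.
by rewrite sumr_const card_ord mulVf.
Qed.

(** The Fejér kernel is a squared modulus, so its increment is a sum of two
    products of conjugate factors: the half-difference, whose mean square is
    of order [(n h)^2], and the half-sum, of order [1].  The inequality between
    the arithmetic and geometric means, with weight [lam] balancing the two,
    and Parseval's identity give a bound linear in [h]. *)
Lemma mean_fejer_diff n M (a h : R) : (n < M)%N -> 0 < h ->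
  mean M (fun y => `|fejer n (a + h - y) - fejer n (a - y)|) <=
  2 * n.+1%:R * h.
Proof.
move=> nM h0; set N : R := n.+1%:R.
have N0 : 0 < N by rewrite ltr0n.
have [N0W h0W] := (ltW N0, ltW h0).
pose s (i : nat) := sin (i%:R * (h / 2) : R).
pose d (i : nat) := cos (i%:R * (h / 2) : R).
pose lam := 2 / (N * h).
have lam0 : 0 < lam by rewrite divr_gt0// mulr_gt0.
have lam0W := ltW lam0.
(* The two values of the kernel are those at [v + h/2] and [v - h/2]. *)
have step y : `|fejer n (a + h - y) - fejer n (a - y)| <=
    2 / N * (lam * energy n s ((a + h / 2) - y) +
             lam^-1 * energy n d ((a + h / 2) - y)).
  set v := a + h / 2 - y.
  rewrite /fejer -mulrBl normrM [`|N^-1|]ger0_norm ?invr_ge0//.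

  rewrite [leLHS]mulrC [2 / N]mulrC -[leRHS]mulrA ler_wpM2l ?invr_ge0//.
  pose A := \sum_(i < n.+1) d i * cos (i%:R * v).
  pose B := \sum_(i < n.+1) s i * sin (i%:R * v).
  pose A' := \sum_(i < n.+1) d i * sin (i%:R * v).
  pose B' := \sum_(i < n.+1) s i * cos (i%:R * v).
  have -> : energy n (fun=> 1) (a + h - y) = (A - B) ^+ 2 + (A' + B') ^+ 2.
    congr (_ ^+ 2 + _ ^+ 2).
      rewrite /A /B -sumrB; apply: eq_bigr => i _; rewrite mul1r.
      have -> : i%:R * (a + h - y) = i%:R * v + i%:R * (h / 2).
        by rewrite /v; field.
      by rewrite cosD /s /d; ring.
    rewrite /A' /B' -big_split; apply: eq_bigr => i _; rewrite mul1r.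
    have -> : i%:R * (a + h - y) = i%:R * v + i%:R * (h / 2).
      by rewrite /v; field.
    by rewrite sinD /s /d /=; ring.
  have -> : energy n (fun=> 1) (a - y) = (A + B) ^+ 2 + (A' - B') ^+ 2.
    congr (_ ^+ 2 + _ ^+ 2).
      rewrite /A /B -big_split; apply: eq_bigr => i _; rewrite mul1r.
      have -> : i%:R * (a - y) = i%:R * v - i%:R * (h / 2).
        by rewrite /v; field.
      by rewrite cosB /s /d /=; ring.
    rewrite /A' /B' -sumrB; apply: eq_bigr => i _; rewrite mul1r.
    have -> : i%:R * (a - y) = i%:R * v - i%:R * (h / 2).
      by rewrite /v; field.
    by rewrite sinB /s /d; ring.
  rewrite /energy -/A -/B -/A' -/B'.
  have am (x y' : R) : `|x * y'| *+ 2 <= lam * y' ^+ 2 + lam^-1 * x ^+ 2.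
    rewrite normrM -[y' ^+ 2]real_normK ?num_real//.
    rewrite -[x ^+ 2]real_normK ?num_real//.
    have := mulr_ge0 (ltW lam0) (sqr_ge0 (`|y'| - lam^-1 * `|x|)).
    have -> : lam * (`|y'| - lam^-1 * `|x|) ^+ 2 =
      lam * `|y'| ^+ 2 + lam^-1 * `|x| ^+ 2 - (`|x| * `|y'|) *+ 2.
      by field; rewrite gt_eqF.
    by rewrite subr_ge0.
  have -> : (A - B) ^+ 2 + (A' + B') ^+ 2 - ((A + B) ^+ 2 + (A' - B') ^+ 2) =
    4 * (A' * B') - 4 * (A * B) by ring.
  have := am A B; have := am A' B'.
  have := ler_normB (4 * (A' * B')) (4 * (A * B)).
  rewrite ![`|4 * _|]normrM [`|4 : R|]ger0_norm// !mulr2n.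
  lra.
apply: (le_trans (ler_mean M step)).
rewrite meanZ meanD !meanZ !mean_energy//.
have Ss : \sum_(i < n.+1) s i ^+ 2 <= N * (N * h / 2) ^+ 2.
  apply: ler_sum_cst => i; rewrite -real_normK ?num_real//.
  rewrite ler_pXn2r ?nnegrE//; last by rewrite mulr_ge0 ?invr_ge0 ?mulr_ge0.
  apply: (le_trans (ler_norm_sin _)).
  rewrite ger0_norm ?mulr_ge0 ?invr_ge0//.
  by rewrite -mulrA ler_wpM2r ?divr_ge0// ler_nat ltnW.
have Sd : \sum_(i < n.+1) d i ^+ 2 <= N.
  rewrite -[leRHS]mulr1; apply: ler_sum_cst => i; rewrite -real_normK ?num_real//.
  by rewrite -[leRHS](expr1n R 2) ler_pXn2r ?nnegrE ?cos_max.
apply: (@le_trans _ _ (2 / N * (lam * (N * (N * h / 2) ^+ 2) + lam^-1 * N))).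
  rewrite ler_wpM2l ?divr_ge0// lerD// ler_wpM2l ?invr_ge0//.
rewrite le_eqVlt; apply/orP; left; apply/eqP; rewrite /lam; field.
by rewrite !gt_eqF.
Qed.

(** The discrete convolution with the Fejér kernel; by [fejer_mean_cos] it does
    not depend on [M] on polynomials of low degree. *)
Definition fejer_mean n M T x := mean M (fun y => fejer n y * T (x - y)).

Lemma trig_poly_le D D' T : (D <= D')%N -> trig_poly D T -> trig_poly D' T.
Proof.
move=> DD'; elim=> [k c kD||S' T' _ hS _ hT|a T' _ hT].
- by apply: trig_poly_cos; exact: leq_trans DD'.
- exact: trig_poly0.
- exact: trig_polyD.
- exact: trig_polyZ.
Qed.

(** Moving the argument [x] from the polynomial to the kernel; the regularity of
    the kernel becomes usable. *)
Lemma fejer_mean_flip n M D T x : trig_poly D T -> (n.+1 + D <= M)%N ->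
  fejer_mean n M T x = mean M (fun y => fejer n (x - y) * T y).
Proof.
move=> hT nDM; rewrite /fejer_mean.
have := trig_polyM (trig_poly_fejer n) (trig_poly_reflect x hT).
move=> /(trig_poly_le nDM)/(mean_trig_reflect x) => <-.
by apply: eq_mean => y; rewrite subKr.
Qed.

Lemma fejer_mean_cst n M a x : (n < M)%N -> fejer_mean n M (fun=> a) x = a.
Proof.
move=> nM; rewrite /fejer_mean.
rewrite (@eq_mean _ M _ (fun y => a * fejer n y)) => [|y]; last by rewrite mulrC.
rewrite meanZ -(mean_trig_reflect 0 (trig_poly_le nM (trig_poly_fejer n))).
by rewrite mean_fejer// mulr1.
Qed.

Lemma fejer_meanD n M S T x : fejer_mean n M (fun y => S y + T y) x =
  fejer_mean n M S x + fejer_mean n M T x.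
Proof. by rewrite -meanD; apply: eq_mean => y; rewrite mulrDr. Qed.

Lemma fejer_meanZ n M a T x : fejer_mean n M (fun y => a * T y) x =
  a * fejer_mean n M T x.
Proof. by rewrite -meanZ; apply: eq_mean => y; rewrite mulrCA. Qed.

Lemma fejer_meanB n M S T x : fejer_mean n M (fun y => S y - T y) x =
  fejer_mean n M S x - fejer_mean n M T x.
Proof.
rewrite -mulN1r -fejer_meanZ -fejer_meanD.
by apply: eq_mean => y; rewrite mulN1r.
Qed.

Lemma fejer_mean_shift n M T c x :
  fejer_mean n M (fun y => T (y + c)) x = fejer_mean n M T (x + c).
Proof. by apply: eq_mean => y; rewrite addrAC. Qed.

Lemma ler_norm_fejer_mean n M T B x : (n < M)%N -> (forall y, `|T y| <= B) ->
  `|fejer_mean n M T x| <= B.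
Proof.
move=> nM TB; rewrite (le_trans (ler_norm_mean _ _))//.
rewrite -[leRHS](fejer_mean_cst B x nM); apply: ler_mean => y.
by rewrite normrM ger0_norm ?fejer_ge0// ler_wpM2l ?fejer_ge0.
Qed.

(** Bernstein's inequality, up to the constant. *)
Lemma fejer_mean_bernstein n M D T B (x h : R) : trig_poly D T ->
  (n.+1 + D <= M)%N -> 0 < h -> (forall y, `|T y| <= B) ->
  `|fejer_mean n M T (x + h) - fejer_mean n M T x| <= 2 * n.+1%:R * h * B.
Proof.
move=> hT nDM h0 TB; rewrite !(fejer_mean_flip _ hT)//.
have -> : mean M (fun y => fejer n (x + h - y) * T y) -
    mean M (fun y => fejer n (x - y) * T y) =
    mean M (fun y => (fejer n (x + h - y) - fejer n (x - y)) * T y).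
  rewrite -mulN1r -meanZ -meanD.
  by apply: eq_mean => y; rewrite mulN1r mulrBl.
rewrite (le_trans (ler_norm_mean _ _))//.
have B0 : 0 <= B by rewrite (le_trans _ (TB 0)).
apply: (@le_trans _ _ (mean M (fun y => B *
    `|fejer n (x + h - y) - fejer n (x - y)|))).
  by apply: ler_mean => y; rewrite normrM mulrC ler_wpM2r.
rewrite meanZ mulrC ler_wpM2r// mean_fejer_diff//.
by apply: leq_trans nDM; rewrite leq_addr.
Qed.

Lemma sum_eq_nat n (j : nat) : (\sum_(i < n) (i == j :> nat) = (j < n))%N.
Proof.
elim: n => [|n IHn]; first by rewrite big_ord0.
by rewrite big_ord_recr/= IHn; lia.
Qed.

Lemma sum_lt_nat n N k : (n <= N)%N ->
  (\sum_(l < n) (l + k < N) = minn n (N - k))%N.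
Proof.
elim: n => [|n IHn] nN; first by rewrite big_ord0 min0n.
by rewrite big_ord_recr/= IHn; lia.
Qed.

(** The number of pairs of frequencies of the kernel at distance [k]. *)
Lemma sum_diag n k :
  \sum_(i < n) \sum_(l < n) (nat_of_ord i == l + k)%N%:R = (n - k)%:R :> R.
Proof.
rewrite exchange_big/=.
under eq_bigr => l _ do rewrite -natr_sum sum_eq_nat.
by rewrite -natr_sum sum_lt_nat//; congr _%:R; lia.
Qed.

Lemma fejer_mean_cos n M k c x : (n.+1 + k <= M)%N ->
  fejer_mean n M (fun y => cos (k%:R * y + c)) x =
  (n.+1 - k)%:R / n.+1%:R * cos (k%:R * x + c).
Proof.
move=> nkM; rewrite /fejer_mean; set b := k%:R * x + c.
rewrite (@eq_mean _ M _ (fun y => n.+1%:R^-1 * \sum_(i < n.+1) \sum_(l < n.+1)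
  (2^-1 * (cos ((i%:R - (l + k)%:R) * y + b) +
           cos (((i + k)%:R - l%:R) * y + (- b)))))); last first.
  move=> y; rewrite fejerE -mulrA big_distrl/=; congr (_ * _).
  apply: eq_bigr => i _; rewrite big_distrl/=; apply: eq_bigr => l _.
  by rewrite mul_cos !natrD /b; congr (_ * (cos _ + cos _)); ring.
rewrite meanZ [RHS]mulrAC [RHS]mulrC; congr (_ * _).
rewrite (mean_sum M n.+1 (fun i y => \sum_(l < n.+1)
  (2^-1 * (cos ((i%:R - (l + k)%:R) * y + b) +
           cos (((i + k)%:R - l%:R) * y + (- b)))))).
have E (i l : nat) : (i < n.+1)%N -> (l < n.+1)%N ->
    mean M (fun y => 2^-1 * (cos ((i%:R - (l + k)%:R) * y + b) +
           cos (((i + k)%:R - l%:R) * y + (- b)))) =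
    2^-1 * ((i == l + k)%N%:R + (l == i + k)%N%:R) * cos b.
  move=> ni nl; rewrite meanZ meanD !mean_cos_diff; try lia.
  by rewrite cosN [(i + k)%N == l]eq_sym; ring.
transitivity (\sum_(i < n.+1) \sum_(l < n.+1)
    2^-1 * ((nat_of_ord i == l + k)%N%:R + (nat_of_ord l == i + k)%N%:R) * cos b).
  apply: eq_bigr => i _.
  rewrite (mean_sum M n.+1 (fun l y => 2^-1 * (cos ((i%:R - (l + k)%:R) * y + b)
           + cos (((i + k)%:R - l%:R) * y + (- b))))).
  by apply: eq_bigr => l _; rewrite E.
under eq_bigr => i _ do rewrite -big_distrl -big_distrr/= big_split/=.
rewrite -big_distrl -big_distrr/= big_split/= sum_diag.
by rewrite exchange_big/= sum_diag; congr (_ * _); field.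
Qed.

(** The exponent [al] of [n.+1] and [2 al] of [h] interpolate between the two
    bounds [h^al], valid at all scales, and [n^(1 - al) h], valid below the
    scale [1/n] of the kernel; the latter needs [2 al <= 1].  The error [e]
    allows for a polynomial that only approximates a Hölder function. *)
Lemma fejer_mean_holder n M D T (H al e x h : R) :
  trig_poly D T -> (n.+1 + D <= M)%N -> 0 <= H -> 0 <= e -> 0 < al < 1 / 2 ->
  (forall y z, `|T y - T z| <= H * `|y - z| `^ al + e) -> 0 < h ->
  `|fejer_mean n M T (x + h) - fejer_mean n M T x| <=
  6 * (H * h `^ (al * 2)) * n.+1%:R `^ al + 3 * e.
Proof.
move=> hT nDM H0 e0 /andP[al0 al2] TH h0.
have nM : (n < M)%N by lia.
set N : R := n.+1%:R; have N0 : 0 < N by rewrite ltr0n.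
pose q := N * h; have q0 : 0 < q by rewrite mulr_gt0.
have [[N0W h0W] q0W] := (ltW N0, ltW h0, ltW q0).
have qE : h `^ (al * 2) * (N `^ al) ^+ 2 = q `^ (al * 2).
  by rewrite powRM// [N `^ (al * 2)]powRrM powR_mulrn ?powR_ge0// mulrC.
have p0 : 0 < N `^ al by rewrite powR_gt0.
have h2 : 0 < h `^ (al * 2) by rewrite powR_gt0.
have [p0W h2W] := (ltW p0, ltW h2).
have al0W := ltW al0.
have [q1|q1] := leP 1 q.
(* Steps longer than the resolution of the kernel: averaging cannot increase
   the oscillation. *)
  apply: (@le_trans _ _ (H * h `^ al + e)).
    rewrite -fejer_mean_shift -fejer_meanB ler_norm_fejer_mean// => y.
    by rewrite (le_trans (TH _ _))// addrAC subrr add0r [`|h|]gtr0_norm.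
  apply: lerD; last by lra.
  have : h `^ al <= h `^ (al * 2) * N `^ al.
    rewrite mulr_natr mulr2n powRD; last by rewrite gt_eqF// addr_gt0.
    rewrite -mulrA ler_peMr ?powR_ge0// -powRM// [h * N]mulrC.
    rewrite -/q; have : 1 `^ al <= q `^ al by rewrite ge0_ler_powR ?nnegrE.
    by rewrite powR1.
  move=> /(ler_wpM2l H0)/le_trans; apply; rewrite -!mulrA ler_peMl//.
    by rewrite !mulr_ge0.
  by lra.
(* Shorter steps: a block average of translates of [T] is slowly varying, and
   Bernstein's inequality applies to the small difference. *)
(* The translates run over a length [m h] comparable to the scale [1/N]. *)
pose m := (Num.truncn q^-1).+1.
have q1W := ltW q1.
have qV1 : 1 <= q^-1 by rewrite invr_ge1 ?unitfE ?gt_eqF.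
have m1 : q^-1 <= m%:R by apply/ltW/truncnS_gt.
have m2 : m%:R <= 2 * q^-1.
  have := truncn_le q^-1; rewrite invr_ge0 q0W /m -natr1.
  by move: qV1 => /=; lra.
have m0 : 0 < m%:R :> R by rewrite ltr0n.
have m0W := ltW m0.
pose B := H * (m%:R * h) `^ al + e.
have B0 : 0 <= B by rewrite addr_ge0// mulr_ge0// powR_ge0.
have near_le y i : (i <= m)%N -> `|T (y + i%:R * h) - T y| <= B.
  move=> im; rewrite (le_trans (TH _ _))// addrAC subrr add0r lerD2r.
  rewrite ler_wpM2l// ge0_ler_powR ?nnegrE//.
    by rewrite mulr_ge0.
  by rewrite ger0_norm ?mulr_ge0// ler_wpM2r// ler_nat.
pose Td y := m%:R^-1 * \sum_(i < m) T (y + i%:R * h).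
have hTd : trig_poly D Td.
  apply: trig_polyZ.
  apply: (@trig_poly_sum _ _ _ (fun i y => T (y + i%:R * h))) => i _.
  exact: trig_poly_shift.
have dTd y : `|T y - Td y| <= B.
  rewrite distrC /Td.
  have -> : T y = m%:R^-1 * \sum_(i < m) T y.
    by rewrite sumr_const card_ord -[T y *+ m]mulr_natl mulKf// gt_eqF.
  rewrite -mulrBr -sumrB normrM ger0_norm ?invr_ge0// mulrC.
  rewrite ler_pdivrMr// (le_trans (ler_norm_sum _ _ _))// [leRHS]mulrC.
  apply: ler_sum_cst => i.
  by rewrite near_le// ltnW.
have sTd y : `|Td (y + h) - Td y| <= B / m%:R.
  rewrite /Td -mulrBr normrM ger0_norm ?invr_ge0// mulrC.
  rewrite ler_wpM2r ?invr_ge0//.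
  have -> : \sum_(i < m) T (y + h + i%:R * h) - \sum_(i < m) T (y + i%:R * h) =
      T (y + m%:R * h) - T y.
    rewrite -sumrB -(big_mkord xpredT (fun i =>
      T (y + h + i%:R * h) - T (y + i%:R * h))).
    rewrite (eq_bigr (fun i => T (y + i.+1%:R * h) - T (y + i%:R * h))).
      by rewrite (telescope_sumr (fun i => T (y + i%:R * h)))// mul0r addr0.
    by move=> i _; congr (T _ - _); rewrite -natr1; ring.
  exact: near_le.
have -> : fejer_mean n M T (x + h) - fejer_mean n M T x =
   fejer_mean n M (fun y => Td (y + h) - Td y) x +
   (fejer_mean n M (fun y => T y - Td y) (x + h) -
    fejer_mean n M (fun y => T y - Td y) x).
  by rewrite !fejer_meanB fejer_mean_shift; ring.
have hTTd : trig_poly D (fun y => T y - Td y).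
  by apply: eq_trig_poly (trig_polyD hT (trig_polyZ (-1) hTd)) => y; rewrite mulN1r.
apply: (@le_trans _ _ (3 * q * B)).
  have -> : 3 * q * B = B * q + 2 * N * h * B by rewrite /q; ring.
  rewrite (le_trans (ler_normD _ _))// lerD//.
    apply: ler_norm_fejer_mean => // y; rewrite (le_trans (sTd y))//.
    by rewrite ler_wpM2l// invf_ple ?posrE.
  exact: (fejer_mean_bernstein x hTTd).
have Bq : (m%:R * h) `^ al <= 2 / N `^ al.
  have mh : m%:R * h <= 2 / N.
    rewrite (le_trans (ler_wpM2r h0W m2))// /q le_eqVlt; apply/orP; left.
    by apply/eqP; field; rewrite !gt_eqF.
  apply: (@le_trans _ _ ((2 / N) `^ al)).
    by rewrite ge0_ler_powR ?nnegrE ?mulr_ge0 ?invr_ge0.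
  rewrite powRM ?invr_ge0// -powRN -powR_inv1// -powRrM mulN1r.
  rewrite ler_wpM2r ?powR_ge0// ler1_powR//; lra.
rewrite /B mulrDr lerD//; last by rewrite ler_wpM2r//; lra.
apply: (@le_trans _ _ (3 * q * (H * (2 / N `^ al)))).
  by rewrite ler_wpM2l ?mulr_ge0// ler_wpM2l.
have -> : 3 * q * (H * (2 / N `^ al)) = 6 * H / N `^ al * q by ring.
have -> : 6 * (H * h `^ (al * 2)) * N `^ al = 6 * H / N `^ al * q `^ (al * 2).
  by rewrite -qE; field; rewrite gt_eqF.
rewrite ler_wpM2l ?divr_ge0 ?mulr_ge0// ger1_powR ?q0//.
by lra.
Qed.

End Fejer.

(** * Uniform approximation by trigonometric polynomials *)

Section Density.
Set Implicit Arguments. Unset Strict Implicit. Unset Printing Implicit Defensive.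
Context {R : realType}.
Implicit Types (f T : R -> R).

(** Every point of the circle has a lift within half a period of [x]. *)
Lemma circle_representative (x y : R) : exists2 z, `|x - z| <= pi &
  forall f, periodic f (pi *+ 2) -> f z = f y.
Proof.
have p0 : 0 < pi *+ 2 :> R by rewrite mulrn_wgt0// pi_gt0.
pose w := (x - y) / (pi *+ 2).
have wE : x - y = w * (pi *+ 2) by rewrite /w divfK// gt_eqF.
pose k := Num.floor (w + 2^-1).
exists (y + k%:~R * (pi *+ 2)).
  have /andP[k1 k2] := mem_rg1_floor (w + 2^-1).
  rewrite -/k in k1 k2.
  rewrite opprD addrA wE -mulrBl normrM [`|pi *+ 2|]gtr0_norm//.
  rewrite [leRHS](_ : pi = 2^-1 * (pi *+ 2)); last by rewrite -[pi *+ 2]mulr_natl mulKf.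
  rewrite ler_wpM2r ?(ltW p0)// ler_norml; lra.
move=> f hf; case: (k) => n.
  by rewrite -pmulrn mulr_natl periodicn.
rewrite NegzE mulrNz -pmulrn mulNr mulr_natl.
by rewrite -(periodicn hf n.+1 (y - _)) subrK.
Qed.

(** Korovkin's argument: by periodicity and uniform continuity,
    [|f y - f x|] is at most [e/2 + C (1 - cos (x - y))] for all [x] and [y],
    and the Fejér kernel of order [n] integrates [1 - cos] to [1 / (n + 1)].
    So the Fejér means converge uniformly. *)
Lemma trig_poly_dense f B (e : R) : periodic f (pi *+ 2) ->
  (forall x, `|f x| <= B) ->
  (forall e, 0 < e -> exists2 d, 0 < d &
    forall x y, `|x - y| < d -> `|f x - f y| <= e) ->
  0 < e -> exists D T, trig_poly D T /\ forall x, `|T x - f x| <= e.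
Proof.
move=> hf fB uc e0; have e20 : 0 < e / 2 by rewrite divr_gt0.
have [d' d'0 fd'] := uc _ e20.
pose d := Num.min d' pi.
have d0 : 0 < d by rewrite lt_min d'0 pi_gt0.
have dpi : d <= pi by rewrite ge_min lexx orbT.
have k0 : 0 < 1 - cos d.
  rewrite subr_gt0 -[ltRHS]cos0 ltr_cos// in_itv/= ?lexx ?pi_ge0//.
  by rewrite (ltW d0).
have B0 : 0 <= B by rewrite (le_trans _ (fB 0)).
pose C := 2 * B / (1 - cos d).
have C0 : 0 <= C by rewrite divr_ge0 ?mulr_ge0// ltW.
have key x y : `|f y - f x| <= e / 2 + C * (1 - cos (x - y)).
  have [z xz fz] := circle_representative x y.
  rewrite -(fz f hf).
  have <- : cos (x - z) = cos (x - y).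
    apply: (fz (fun t => cos (x - t))) => t.
    by rewrite -[in RHS]cosN -[in LHS]cosN !opprB addrAC cosD2pi.
  have [xzd|xzd] := ltP `|x - z| d.
    rewrite distrC (le_trans (fd' x z _))//.
      by rewrite (lt_le_trans xzd)// ge_min lexx.
    by rewrite lerDl mulr_ge0// subr_ge0 cos_le1.
  have cd : cos (x - z) <= cos d.
    rewrite -cos_norm leNgt ltr_cos ?in_itv/= ?xz ?normr_ge0 ?dpi ?(ltW d0)//.
    by rewrite -leNgt.
  apply: (@le_trans _ _ (2 * B)).
    by rewrite (le_trans (ler_normB _ _))// mulr_natl mulr2n lerD.
  apply: (@le_trans _ _ (C * (1 - cos d))).
    by rewrite /C divfK// gt_eqF.
  rewrite -[leLHS]add0r lerD ?(ltW e20)// ler_wpM2l//; lra.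
pose n := Num.truncn (C / (e / 2)).
have nC : C / n.+1%:R <= e / 2.
  rewrite ler_pdivrMr ?ltr0n// mulrC -ler_pdivrMr//.
  by apply/ltW/truncnS_gt.
have nM : (n < n.+3)%N by lia.
exists n.+1, (fun x => mean n.+3 (fun y => fejer n (x - y) * f y)); split.
  rewrite /mean.
  apply: (eq_trig_poly (fun x => mulrC _ _)); apply: trig_polyZ.
  apply: (@trig_poly_sum _ _ _ (fun j x =>
    fejer n (x - pi *+ 2 * (j%:R / n.+3%:R)) *
    f (pi *+ 2 * (j%:R / n.+3%:R)))) => j _.
  apply: (eq_trig_poly (fun x => mulrC _ _)); apply: trig_polyZ.
  exact/trig_poly_shift/trig_poly_fejer.
move=> x.
have -> : mean n.+3 (fun y => fejer n (x - y) * f y) - f x =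
    mean n.+3 (fun y => fejer n (x - y) * (f y - f x)).
  rewrite (@eq_mean _ n.+3 (fun y => fejer n (x - y) * (f y - f x)) (fun y =>
    fejer n (x - y) * f y + (- f x) * fejer n (x - y))); last first.
    by move=> y; ring.
  by rewrite meanD meanZ mean_fejer// mulr1.
have mc : mean n.+3 (fun y => fejer n (x - y) * cos (x - y)) = n%:R / n.+1%:R.
  have c1 : (1 < 2)%N by [].
  have := @fejer_mean_flip _ n n.+3 2 _ x (trig_poly_cos (- x) c1).
  rewrite fejer_mean_cos; try lia.
  rewrite mul1r subrr cos0 mulr1 subn1 => ->; last lia.
  by apply: eq_mean => y; rewrite mul1r -cosN opprB.
apply: (le_trans (ler_norm_mean _ _)).
apply: (@le_trans _ _ (mean n.+3 (fun y => (e / 2 + C) * fejer n (x - y) +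
   (- C) * (fejer n (x - y) * cos (x - y))))).
  apply: ler_mean => y; rewrite normrM ger0_norm ?fejer_ge0//.
  apply: (le_trans (ler_wpM2l (fejer_ge0 n (x - y)) (key x y))).
  by rewrite le_eqVlt; apply/orP; left; apply/eqP; ring.
rewrite meanD !meanZ mean_fejer// mc.
have -> : (e / 2 + C) * 1 + - C * (n%:R / n.+1%:R) = e / 2 + C / n.+1%:R.
  by field; rewrite nat1r pnatr_eq0.
by rewrite [leRHS](splitr e) lerD2l.
Qed.

End Density.

(** * Decay of the differences of the symbol *)

Section Symbol.
Set Implicit Arguments. Unset Strict Implicit. Unset Printing Implicit Defensive.
Context {R : realType}.
Local Notation m n := (@whitham_symbol R n%:R).

Lemma whitham_symbol0 : m 0 = 1.
Proof. by rewrite /whitham_symbol eqxx. Qed.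

(** The symbol at [n] is [n^(-1/2) sqrt (tanh n)], and [1 - tanh n] decays
    exponentially.  The cubic error term, written with powers of [sqrt n], is
    small enough for the second differences below. *)
Lemma whitham_symbol_bounds n : (0 < n)%N ->
  (Num.sqrt n%:R)^-1 - 7 / Num.sqrt n%:R ^+ 6 <= m n <= (Num.sqrt n%:R)^-1.
Proof.
move=> n0; set a := Num.sqrt n%:R.
have n0R : 0 < n%:R :> R by rewrite ltr0n.
have a0 : 0 < a by rewrite sqrtr_gt0.
have a1 : 1 <= a by rewrite -[1]sqrtr1 ler_sqrt// ler1n.
rewrite /whitham_symbol gt_eqF//.
set x : R := n%:R.
have xE : x = a ^+ 2 by rewrite /a sqr_sqrtr// ltW.
have E0 : 0 < expR x by exact: expR_gt0.
pose t := tanh x.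
have tE : t = 1 - 2 / (expR x ^+ 2 + 1).
  rewrite /t /tanh expRN; field.
  by rewrite !gt_eqF// addr_gt0// exprn_gt0.
(* exp(2x) dominates x^3, so the defect of tanh is below every needed power. *)
have E3 : (2 * x / 3) ^+ 3 <= expR x ^+ 2.
  have -> : expR x ^+ 2 = expR (2 * x / 3) ^+ 3.
    by rewrite -!expRM_natl; congr expR; field.
  rewrite ler_pXn2r ?nnegrE ?expR_ge0 ?mulr_ge0//.
  by rewrite (le_trans _ (expR_ge1Dx _))// lerDr.
have td : 2 / (expR x ^+ 2 + 1) <= 7 / x ^+ 3.
  rewrite ler_pdivrMr ?addr_gt0 ?exprn_gt0// mulrAC ler_pdivlMr ?exprn_gt0//.
  by move: E3; rewrite !exprMn exprVn; nra.
have d0 : 0 <= 2 / (expR x ^+ 2 + 1) by rewrite divr_ge0 ?addr_ge0 ?sqr_ge0.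
have d1 : 2 / (expR x ^+ 2 + 1) <= 1.
  rewrite ler_pdivrMr ?addr_gt0 ?exprn_gt0// mul1r.
  have : 1 <= expR x by rewrite -[leLHS]expR0 ler_expR ltW.
  by nra.
have t0 : 0 <= t by rewrite tE subr_ge0.
have t1 : t <= 1 by rewrite tE; lra.
have st1 : t <= Num.sqrt t.
  by rewrite -{1}(sqr_sqrtr t0) expr2 ler_piMr ?sqrtr_ge0// -[leRHS]sqrtr1 ler_sqrt.
have st2 : Num.sqrt t <= 1 by rewrite -[leRHS]sqrtr1 ler_sqrt.
have dt : 7 / a ^+ 6 = 7 / x ^+ 3 by rewrite xE -exprM.
rewrite -/t sqrtrM// sqrtrV ?(ltW n0R)// -/a dt; apply/andP; split.
  rewrite lerBlDr -{1}[a^-1]mul1r -lerBlDl -mulrBl.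
  apply: (@le_trans _ _ (1 - Num.sqrt t)).
    by rewrite ler_piMr ?subr_ge0// invf_le1.
  by rewrite (le_trans _ td)// (le_trans (lerB (lexx 1) st1))// tE; lra.
by rewrite ler_piMl// invr_ge0 (ltW a0).
Qed.

Let rt n : R := Num.sqrt n.+1%:R.

Let rt_ge1 n : 1 <= rt n.
Proof. by rewrite -[leLHS]sqrtr1 ler_sqrt// ler1n. Qed.

Let rtS n : rt n.+1 ^+ 2 = rt n ^+ 2 + 1.
Proof. by rewrite !sqr_sqrtr// natr1. Qed.

Lemma symbol_bound n : `|m n| <= 1.
Proof.
case: n => [|n]; first by rewrite whitham_symbol0 normr1.
have m0 : 0 <= m n.+1 by rewrite /whitham_symbol; case: ifP.
have /andP[_] := @whitham_symbol_bounds n.+1 isT.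
rewrite ger0_norm// => /le_trans; apply.
by rewrite invf_le1 ?rt_ge1// sqrtr_gt0.
Qed.

Lemma symbol_decay n : `|m n.+1| <= (rt n)^-1.
Proof.
have /andP[_] := @whitham_symbol_bounds n.+1 isT.
by rewrite ger0_norm// /whitham_symbol; case: ifP.
Qed.

Lemma symbol_diff1_decay n : `|m n - m n.+1| <= 200 / rt n ^+ 3.
Proof.
case: n => [|n].
  rewrite /rt sqrtr1 expr1n divr1 (le_trans (ler_normB _ _))//.
  by rewrite (le_trans (lerD (symbol_bound _) (symbol_bound _)))//; lra.
have /andP[h1 h2] := @whitham_symbol_bounds n.+1 isT.
have /andP[h3 h4] := @whitham_symbol_bounds n.+2 isT.
move: (rt_ge1 n) (rt_ge1 n.+1) (rtS n) h1 h2 h3 h4; rewrite /rt.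
set a := Num.sqrt n.+1%:R; set b := Num.sqrt n.+2%:R => a1 b1 ab h1 h2 h3 h4.
have a0 : 0 < a by lra.
have b0 : 0 < b by lra.
have lab : a <= b by nra.
have lb : b <= 2 * a by nra.
have D : a^-1 - b^-1 = (a * b * (a + b))^-1.
  have -> : a^-1 - b^-1 = (b ^+ 2 - a ^+ 2) * (a * b * (a + b))^-1.
    by field; rewrite !gt_eqF// addr_gt0.
  by rewrite ab addrAC subrr add0r mul1r.
have [a0W b0W] := (ltW a0, ltW b0).
have D0 : 0 <= (a * b * (a + b))^-1 by rewrite invr_ge0 !mulr_ge0 ?addr_ge0.
have DA : (a * b * (a + b))^-1 <= (a ^+ 3)^-1.
  by rewrite lef_pV2 ?posrE ?exprn_gt0 ?mulr_gt0 ?addr_gt0//; nra.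
have A6 : (a ^+ 6)^-1 <= (a ^+ 3)^-1.
  by rewrite lef_pV2 ?posrE ?exprn_gt0// ler_weXn2l.
have B6 : (b ^+ 6)^-1 <= (a ^+ 3)^-1.
  rewrite (le_trans _ A6)// lef_pV2 ?posrE ?exprn_gt0// ler_pXn2r// ?nnegrE.
have AB : (a ^+ 3)^-1 <= 8 * (b ^+ 3)^-1.
  rewrite -[8]invrK -invfM lef_pV2 ?posrE ?exprn_gt0 ?mulr_gt0 ?invr_gt0 ?exprn_gt0//.
  rewrite mulrC ler_pdivrMr// (_ : a ^+ 3 * 8 = (2 * a) ^+ 3); last by ring.
  by rewrite ler_pXn2r ?nnegrE ?mulr_ge0.
by rewrite ler_norml; apply/andP; split; lra.
Qed.

(** With [a], [b], [c] the square roots of three consecutive integers, the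
    second difference of [k^(-1/2)] is
    [(b (c - a) + 2) / (a b c (a + b) (b + c))], which is at most [a^(-5)]
    because [b (c - a) <= (a + c) (c - a) = 2].  The constant is generous. *)
Lemma symbol_diff2_decay n :
  `|m n - 2 * m n.+1 + m n.+2| <= 1000 / rt n ^+ 5.
Proof.
case: n => [|n].
  rewrite /rt sqrtr1 expr1n divr1 (le_trans (ler_normD _ _))//.
  rewrite (le_trans (lerD (ler_normB _ _) (symbol_bound _)))// normrM.
  have := symbol_bound 0; have := symbol_bound 1.
  by rewrite [`|2|]ger0_norm//; lra.
have /andP[h1 h2] := @whitham_symbol_bounds n.+1 isT.
have /andP[h3 h4] := @whitham_symbol_bounds n.+2 isT.
have /andP[h5 h6] := @whitham_symbol_bounds n.+3 isT.
move: (rt_ge1 n) (rt_ge1 n.+1) (rt_ge1 n.+2) (rtS n) (rtS n.+1).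
move: h1 h2 h3 h4 h5 h6; rewrite /rt.
set a := Num.sqrt n.+1%:R; set b := Num.sqrt n.+2%:R; set c := Num.sqrt n.+3%:R.
move=> h1 h2 h3 h4 h5 h6 a1 b1 c1 ab bc.
have a0 : 0 < a by lra.
have b0 : 0 < b by lra.
have c0 : 0 < c by lra.
have lab : a <= b by nra.
have lbc : b <= c by nra.
have lb : b <= 2 * a by nra.
have [[a0W b0W] c0W] := (ltW a0, ltW b0, ltW c0).
pose Q := a * b * c * (a + b) * (b + c).
have Q0 : 0 < Q by rewrite !mulr_gt0 ?addr_gt0.
have E : a^-1 - 2 * b^-1 + c^-1 = (b * (c - a) + 2) / Q.
  have -> : a^-1 - 2 * b^-1 + c^-1 =
      (b ^+ 2 - a ^+ 2) * (a * b * (a + b))^-1 -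
      (c ^+ 2 - b ^+ 2) * (b * c * (b + c))^-1.
    by field; rewrite !gt_eqF// addr_gt0.
  rewrite bc ab ![_ + 1]addrC !addrK !mul1r.
  have -> : 2 = c ^+ 2 - a ^+ 2 :> R by rewrite bc ab; ring.
  by rewrite /Q; field; rewrite !gt_eqF// addr_gt0.
have E0 : 0 <= (b * (c - a) + 2) / Q.
  by rewrite divr_ge0 ?(ltW Q0)// addr_ge0// mulr_ge0// subr_ge0 (le_trans lab).
have EA : (b * (c - a) + 2) / Q <= (a ^+ 5)^-1.
  rewrite ler_pdivrMr// [leRHS]mulrC ler_pdivlMr ?exprn_gt0//.
  have n4 : b * (c - a) + 2 <= 4.
    have : b * (c - a) <= (a + c) * (c - a).
      by rewrite ler_wpM2r ?subr_ge0 ?(le_trans lab lbc)//; lra.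
    rewrite (_ : (a + c) * (c - a) = c ^+ 2 - a ^+ 2); last by ring.
    by rewrite bc ab; lra.
  apply: (@le_trans _ _ (4 * a ^+ 5)); first by rewrite ler_wpM2r ?exprn_ge0.
  have -> : 4 * a ^+ 5 = a * a * a * (2 * a) * (2 * a) by ring.
  by rewrite /Q !ler_pM ?mulr_ge0//; lra.
have A6 : (a ^+ 6)^-1 <= (a ^+ 5)^-1.
  by rewrite lef_pV2 ?posrE ?exprn_gt0// ler_weXn2l.
have B6 : (b ^+ 6)^-1 <= (a ^+ 5)^-1.
  by rewrite (le_trans _ A6)// lef_pV2 ?posrE ?exprn_gt0// ler_pXn2r// ?nnegrE.
have C6 : (c ^+ 6)^-1 <= (a ^+ 5)^-1.
  rewrite (le_trans _ B6)// lef_pV2 ?posrE ?exprn_gt0// ler_pXn2r// ?nnegrE//.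
have AB : (a ^+ 5)^-1 <= 32 * (b ^+ 5)^-1.
  rewrite -[32]invrK -invfM lef_pV2 ?posrE ?exprn_gt0 ?mulr_gt0 ?invr_gt0 ?exprn_gt0//.
  rewrite mulrC ler_pdivrMr// (_ : a ^+ 5 * 32 = (2 * a) ^+ 5); last by ring.
  by rewrite ler_pXn2r ?nnegrE ?mulr_ge0.
by rewrite ler_norml; apply/andP; split; lra.
Qed.

(** Comparison with the telescoping series of [n^(-e) / e], by
    [ln x <= x - 1]. *)
Lemma sum_powR_le (e : R) N : 0 < e ->
  \sum_(n < N) n.+1%:R `^ (- (1 + e)) <= 1 + e^-1.
Proof.
move=> e0; case: N => [|N].
  by rewrite big_ord0 addr_ge0// invr_ge0 ltW.
suff : \sum_(n < N.+1) n.+1%:R `^ (- (1 + e)) <=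
       1 + e^-1 - e^-1 * N.+1%:R `^ (- e).
  move=> /le_trans; apply.
  by rewrite gerBl mulr_ge0 ?powR_ge0// invr_ge0 ltW.
elim: N => [|N IHN].
  by rewrite big_ord1 !powR1 mulr1 addrK.
rewrite big_ord_recr/= (le_trans (lerD IHN (lexx _)))//.
set p : R := N.+1%:R; set q : R := N.+2%:R.
have p0 : 0 < p by rewrite ltr0n.
have q0 : 0 < q by rewrite ltr0n.
have pq : p = q - 1 by rewrite /p /q -[N.+2%:R]natr1 addrK.
have qe : q `^ (- (1 + e)) = q `^ (- e) / q.
  rewrite opprD addrC powRD; last by rewrite (gt_eqF q0) implybT.
  by rewrite powR_inv1// ltW.
have pe : q `^ (- e) * (1 + e / q) <= p `^ (- e).
  have -> : p `^ (- e) = q `^ (- e) * (p / q) `^ (- e).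
    by rewrite -powRM ?divr_ge0 ?ltW// mulrC divfK// gt_eqF.
  rewrite ler_wpM2l ?powR_ge0// /powR gt_eqF ?divr_gt0//.
  rewrite (le_trans _ (expR_ge1Dx _))// lerD2l mulNr -mulrN ler_wpM2l ?(ltW e0)//.
  have -> : p / q = 1 + (- q^-1) by rewrite pq mulrBl divff ?mul1r// gt_eqF.
  rewrite -[leLHS]opprK lerN2 le_ln1Dx//.
  by rewrite ltrN2 invf_lt1// ltr1n.
rewrite qe -subr_ge0.
have -> : 1 + e^-1 - e^-1 * q `^ (- e) -
    (1 + e^-1 - e^-1 * p `^ (- e) + q `^ (- e) / q) =
    e^-1 * (p `^ (- e) - q `^ (- e) * (1 + e / q)).
  by field; rewrite !gt_eqF.
by rewrite mulr_ge0 ?invr_ge0 ?(ltW e0)// subr_ge0.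
Qed.

End Symbol.

(** * Convolution with an integrable kernel *)

Section Convolution.
Set Implicit Arguments. Unset Strict Implicit. Unset Printing Implicit Defensive.
Context {R : realType}.
Local Notation mu := (@lebesgue_measure R).

(** The change of variables relating the two forms of the convolution; typed
    with the Borel sigma-algebra so that its pushforward is a measure. *)
Definition reflection (x : R) : measurableTypeR R -> measurableTypeR R :=
  fun y => x - y.

Lemma measurable_reflection (x : R) : measurable_fun setT (reflection x).
Proof. by apply: measurable_funB => //; exact: measurable_cst. Qed.

HB.instance Definition _ (x : R) :=
  isMeasurableFun.Build _ _ _ _ (reflection x) (measurable_reflection x).

Lemma pushforward_reflection (x : R) (A : set R) : measurable A ->
  mu A = pushforward mu (reflection x) A.
Proof.
move=> mA; apply: lebesgue_measure_unique => // _ [[a b]] _ <-.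
have E : reflection x @^-1` [set` `]a, b]] = [set` `[x - b, x - a[].
  by apply/seteqP; split => y /=; rewrite /reflection !in_itv/=; lra.
transitivity (mu [set` `[x - b, x - a[]); last exact: (congr1 mu (esym E)).
rewrite !lebesgue_measure_itv/= !lte_fin ltrD2l ltrN2; case: ifP => // _.
by rewrite -!EFinB; congr EFin; ring.
Qed.

Lemma integrable_reflection (K : R -> R) x : mu.-integrable setT (EFin \o K) ->
  mu.-integrable setT (EFin \o (fun y => K (x - y))).
Proof.
move=> /integrableP[mK iK]; apply/integrableP; split.
  by apply: (measurableT_comp mK); exact: measurable_reflection.
apply: le_lt_trans iK; rewrite le_eqVlt; apply/orP; left; apply/eqP.
transitivity (\int[pushforward mu (reflection x)]_y `|(EFin \o K) y|%E)%E.
  by rewrite ge0_integral_pushforward//; exact: measurableT_comp.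
by apply: eq_measure_integral => A mA _; exact/esym/pushforward_reflection.
Qed.

Lemma Rintegral_reflection (K : R -> R) x : mu.-integrable setT (EFin \o K) ->
  \int[mu]_y K (x - y) = \int[mu]_y K y.
Proof.
move=> iK; rewrite /Rintegral; congr fine.
transitivity (\int[pushforward mu (reflection x)]_y (EFin \o K) y)%E.
  rewrite integral_pushforward//; first by case/integrableP : iK.
  exact: integrable_reflection.
by apply: eq_measure_integral => A mA _; exact/esym/pushforward_reflection.
Qed.

Lemma integrableM_bounded (K f : R -> R) B : mu.-integrable setT (EFin \o K) ->
  continuous f -> (forall x, `|f x| <= B) ->
  mu.-integrable setT (EFin \o (fun y => K y * f y)).
Proof.
move=> iK cf fB.
have mf : measurable_fun setT f by exact: continuous_measurable_fun.
have bf : [bounded f x | x in setT].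
  exists B; split; first exact: num_real.
  by move=> r Br x _ /=; rewrite (le_trans (fB x))// ltW.
exact: (integrableMl measurableT iK mf bf).
Qed.

Context (K : R -> R) (HK : is_whitham_kernel K).

Implicit Types (f g : R -> R) (a B C x : R).

Definition L1norm : R := \int[mu]_y `|K y|.

Lemma L1norm_ge0 : 0 <= L1norm.
Proof. exact: Rintegral_ge0. Qed.

Let iK := HK.1.

Let icomp (f : R -> R) B x : continuous f -> (forall x, `|f x| <= B) ->
  mu.-integrable setT (EFin \o (fun y => K (x - y) * f y)).
Proof. exact/integrableM_bounded/integrable_reflection. Qed.

Lemma ler_norm_convolution f B x : continuous f -> (forall x, `|f x| <= B) ->
  `|convolution K f x| <= L1norm * B.
Proof.
move=> cf fB; rewrite /convolution.
have iKx := integrable_reflection x iK.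
have inK : mu.-integrable setT (EFin \o (fun y => `|K y|)).
  exact: (integrable_norm iK).
have inKx := integrable_reflection x inK.
apply: (le_trans (le_normr_Rintegral _ (icomp x cf fB))) => //.
rewrite /L1norm -(Rintegral_reflection x inK) -RintegralZr//.
apply: le_Rintegral => //.
- exact: (integrable_norm (icomp x cf fB)).
- exact: (integrableZr measurableT B inKx).
- by move=> y _; rewrite normrM ler_wpM2l.
Qed.

Lemma convolutionD f g B C x : continuous f -> (forall x, `|f x| <= B) ->
  continuous g -> (forall x, `|g x| <= C) ->
  convolution K (fun y => f y + g y) x = convolution K f x + convolution K g x.
Proof.
move=> cf fB cg gC; rewrite /convolution.
under eq_Rintegral do rewrite mulrDr.
by rewrite RintegralD//; exact: icomp.
Qed.

Lemma convolutionZ a f B x : continuous f -> (forall x, `|f x| <= B) ->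
  convolution K (fun y => a * f y) x = a * convolution K f x.
Proof.
move=> cf fB; rewrite /convolution.
under eq_Rintegral do rewrite mulrCA.
by rewrite RintegralZl//; exact: icomp.
Qed.

Lemma ler_dist_convolution f g B C e x :
  continuous f -> (forall x, `|f x| <= B) ->
  continuous g -> (forall x, `|g x| <= C) ->
  (forall x, `|f x - g x| <= e) ->
  `|convolution K f x - convolution K g x| <= L1norm * e.
Proof.
move=> cf fB cg gC fg.
have cNg : continuous (fun y => - 1 * g y).
  by move=> u; apply: cvgM; [exact: cvg_cst|exact: cg].
have NgC u : `|- 1 * g u| <= C by rewrite mulN1r normrN.
rewrite -[X in _ - X]mul1r -mulNr -(convolutionZ _ _ cg gC).
rewrite -(convolutionD _ cf fB cNg NgC); apply: ler_norm_convolution => u.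
  by apply: cvgD; [exact: cf|exact: cNg].
by rewrite mulN1r.
Qed.

(** The addition formula splits the integral into the cosine and sine
    transforms of [K]; the latter vanishes because the symbol is real. *)
Lemma convolution_cos (k c x : R) :
  convolution K (fun y => cos (k * y + c)) x =
  whitham_symbol k * cos (k * x + c).
Proof.
have [hc hs] : \int[mu]_y (K y * cos (y * k)) = whitham_symbol k /\
    \int[mu]_y (K y * sin (y * k)) = 0.
  have := HK.2 k; rewrite /fourier => -[-> hs]; split => //.
  by apply/eqP; rewrite -oppr_eq0 hs.
have clin (g : R -> R) : continuous g -> continuous (fun y : R => g (y * k)).
  move=> cg y; apply: (@continuous_comp R R R (fun y => y * k) g); last exact: cg.
  by apply: cvgM; [exact: cvg_id|exact: cvg_cst].
have ic : mu.-integrable setT (EFin \o (fun y => K y * cos (y * k))).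
  apply: (@integrableM_bounded K (fun y => cos (y * k)) 1) => //.
    exact/clin/continuous_cos.
  by move=> y; exact: cos_max.
have isn : mu.-integrable setT (EFin \o (fun y => K y * sin (y * k))).
  apply: (@integrableM_bounded K (fun y => sin (y * k)) 1) => //.
    exact/clin/continuous_sin.
  by move=> y; exact: sin_max.
pose b := k * x + c.
pose G y := cos b * (K y * cos (y * k)) + sin b * (K y * sin (y * k)).
have iG1 : mu.-integrable setT (EFin \o (fun y => cos b * (K y * cos (y * k)))).
  exact: (integrableZl measurableT (cos b) ic).
have iG2 : mu.-integrable setT (EFin \o (fun y => sin b * (K y * sin (y * k)))).
  exact: (integrableZl measurableT (sin b) isn).
have iG : mu.-integrable setT (EFin \o G).
  exact: (integrableD measurableT iG1 iG2).
transitivity (\int[mu]_y G (x - y)).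
  apply: eq_Rintegral => y _; rewrite /G.
  have -> : k * y + c = b - (x - y) * k by rewrite /b; ring.
  by rewrite cosB; ring.
by rewrite Rintegral_reflection// /G RintegralD// !RintegralZl// hc hs; ring.
Qed.

End Convolution.

(** * The convolution gains half a derivative *)

Section Smoothing.
Set Implicit Arguments. Unset Strict Implicit. Unset Printing Implicit Defensive.
Context {R : realType}.
Implicit Types (f T : R -> R) (D M N : nat) (al e h x H : R).

(** The function [k |-> n.+1 - k], truncated at [0], is [n.+1] times the
    multiplier of the Fejér mean of order [n]; these hat functions generate
    every finite sequence, with its second differences as coefficients. *)
Lemma abel_summation (a : nat -> R) N k : (k <= N)%N ->
  a k = \sum_(n < N) (n.+1 - k)%:R * (a n - 2 * a n.+1 + a n.+2) +
        (N.+1 - k)%:R * (a N - a N.+1) + a N.+1.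
Proof.
elim: N => [|N IHN].
  by rewrite leqn0 => /eqP ->; rewrite big_ord0 mul1r add0r subrK.
rewrite leq_eqVlt => /predU1P[->|kN].
  rewrite big1 ?add0r => [|n _].
    by rewrite subSn// subnn mul1r subrK.
  have -> : (n.+1 - N.+1 = 0)%N by have := ltn_ord n; lia.
  by rewrite mul0r.
rewrite {1}(IHN kN) big_ord_recr/=.
have -> : (N.+2 - k = (N.+1 - k).+1)%N by lia.
by rewrite -natr1; ring.
Qed.

(** A modulus of continuity depending on [H] and [al] only, hence common to an
    equi-Hölder family. *)
Lemma powR_small H al e : 0 < al -> 0 < e -> 0 <= H ->
  exists2 d, 0 < d & forall r, 0 <= r -> r < d -> H * r `^ al <= e.
Proof.
move=> al0 e0 H0.
have eH : 0 < e / (H + 1) by rewrite divr_gt0// ltr_wpDl.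
exists ((e / (H + 1)) `^ al^-1); first by rewrite powR_gt0.
move=> r r0 rd; apply: (@le_trans _ _ (H * (e / (H + 1)))).
  rewrite ler_wpM2l//.
  rewrite [leRHS](_ : _ = ((e / (H + 1)) `^ al^-1) `^ al).
    by rewrite ge0_ler_powR ?nnegrE ?powR_ge0// ltW.
  by rewrite -powRrM mulVf ?gt_eqF// powRr1// ltW.
rewrite mulrCA ler_piMr ?(ltW e0)// ler_pdivrMr ?mul1r ?lerDl//.
by rewrite ltr_wpDl.
Qed.

Lemma holder_modulus f H al e : 0 < al -> 0 < e -> 0 <= H ->
  (forall x y, `|f x - f y| <= H * `|x - y| `^ al) ->
  exists2 d, 0 < d & forall x y, `|x - y| < d -> `|f x - f y| <= e.
Proof.
move=> al0 e0 H0 fH; have [d d0 dP] := powR_small al0 e0 H0.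
by exists d => // x y xy; rewrite (le_trans (fH x y))// dP.
Qed.

Lemma holder_continuous f H al : 0 < al -> 0 <= H ->
  (forall x y, `|f x - f y| <= H * `|x - y| `^ al) -> continuous f.
Proof.
move=> al0 H0 fH x; apply/cvgrPdist_le => e e0.
have [d d0 fd] := holder_modulus al0 e0 H0 fH.
near=> y; apply: fd; near: y.
by apply: cvgr_dist_lt => //; exact: cvg_id.
Unshelve. all: by end_near. Qed.

Lemma holder_periodic_bounded f H al : 0 <= al -> 0 <= H ->
  periodic f (pi *+ 2) ->
  (forall x y, `|f x - f y| <= H * `|x - y| `^ al) ->
  forall x, `|f x| <= `|f 0| + H * pi `^ al.
Proof.
move=> al0 H0 pf fH x.
have [z xz fz] := circle_representative 0 x.
have <- : f z = f x by exact: fz.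
rewrite addrC -lerBlDr (le_trans (lerB_dist _ _))// distrC (le_trans (fH _ _))//.
by rewrite ler_wpM2l// ge0_ler_powR ?nnegrE ?pi_ge0.
Qed.

Lemma holder_cst_ge0 f H al :
  (forall x y, `|f x - f y| <= H * `|x - y| `^ al) -> 0 <= H.
Proof.
by move=> /(_ 1 0); rewrite subr0 normr1 powR1 mulr1; exact: le_trans.
Qed.

Context (K : R -> R) (HK : is_whitham_kernel K).
Local Notation m n := (@whitham_symbol R n%:R).

(** The Fejér means of order up to [N] see all the frequencies of [T], so the
    superposition is a finite sum; the last two terms are its remainder. *)
Lemma convolution_trig D T N M x : trig_poly D T -> (D <= N.+1)%N ->
  (N.+1 + D <= M)%N ->
  convolution K T x =
  \sum_(n < N) n.+1%:R * (m n - 2 * m n.+1 + m n.+2) * fejer_mean n M T x +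
  N.+1%:R * (m N - m N.+1) * fejer_mean N M T x + m N.+1 * T x.
Proof.
move=> hT DN NDM; elim: hT => [k c kD||S' T' hS IS hT IT|a T' hT IT].
- rewrite convolution_cos// (@abel_summation (fun n => m n) N k); last lia.
  rewrite fejer_mean_cos; last lia.
  rewrite mulrDl mulrDl big_distrl/=; congr (_ + _ + _); last first.
    by field; rewrite nat1r pnatr_eq0.
  apply: eq_bigr => n _; rewrite fejer_mean_cos; last by have := ltn_ord n; lia.
  by field; rewrite nat1r pnatr_eq0.
- have cst0 n y : fejer_mean n M (fun=> 0 : R) y = 0.
    by rewrite /fejer_mean -[RHS](mean0 M); apply: eq_mean => z; rewrite mulr0.
  rewrite big1 ?add0r => [|n _]; last by rewrite cst0 mulr0.
  rewrite cst0 !mulr0 addr0; apply/eqP; rewrite -normr_le0.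
  rewrite -[leRHS](mulr0 (L1norm K)).
  apply: (ler_norm_convolution HK) => y; first exact: cvg_cst.
  by rewrite normr0.
- have [B SB] := trig_poly_bounded hS; have [C TC] := trig_poly_bounded hT.
  rewrite (convolutionD HK x (trig_poly_continuous hS) SB
    (trig_poly_continuous hT) TC) IS IT fejer_meanD.
  under [in RHS]eq_bigr do rewrite fejer_meanD mulrDr.
  by rewrite big_split/=; ring.
- have [B TB] := trig_poly_bounded hT.
  rewrite (convolutionZ HK a x (trig_poly_continuous hT) TB) IT fejer_meanZ.
  under [in RHS]eq_bigr do rewrite fejer_meanZ mulrCA.
  by rewrite -big_distrr/=; ring.
Qed.

(** Summing the oscillations of the Fejér means against the weights of
    [convolution_trig] leads to the series of [n^(al - 3/2)]. *)
Lemma convolution_trig_holder al : 0 < al < 1 / 2 ->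
  exists2 C, 0 <= C & forall D T H e x h, trig_poly D T -> 0 <= H -> 0 <= e ->
    (forall y z, `|T y - T z| <= H * `|y - z| `^ al + e) -> 0 < h ->
    `|convolution K T (x + h) - convolution K T x| <=
    C * (H * h `^ (al * 2) + e).
Proof.
move=> hal; have /andP[al0 al2] := hal.
pose ep := 1 / 2 - al; have ep0 : 0 < ep by rewrite subr_gt0.
pose Z := 1 + ep^-1; have Z0 : 0 <= Z by rewrite addr_ge0// invr_ge0 ltW.
have [c2 c20 d2] : exists2 c : R, 0 <= c & forall n,
    `|m n - 2 * m n.+1 + m n.+2| <= c / Num.sqrt n.+1%:R ^+ 5.
  by exists 1000; [exact: ler0n|exact: symbol_diff2_decay].
have [c1 c10 d1] : exists2 c : R, 0 <= c & forall n,
    `|m n - m n.+1| <= c / Num.sqrt n.+1%:R ^+ 3.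
  by exists 200; [exact: ler0n|exact: symbol_diff1_decay].
have cZ : 0 <= c2 * Z + c1 by rewrite addr_ge0// mulr_ge0.
exists (6 * (c2 * Z + c1) + 1); first by lra.
move=> D T H e x h hT H0 e0 TH h0.
have h0W := ltW h0.
pose r := (h `^ al) ^- 2.
(* The degree of the summation formula is free: it is taken so large that the
   last multiplier is negligible. *)
have [N [DN rN]] : exists N, (D <= N.+1)%N /\ r <= N.+1%:R.
  exists (maxn D (Num.truncn r)); split; first by rewrite leqW ?leq_maxl.
  by rewrite (le_trans (ltW (truncnS_gt r)))// ler_nat ltnS leq_maxr.
have [M NDM] : exists M, (N.+1 + D <= M)%N by exists (N.+1 + D)%N.
rewrite (convolution_trig _ hT DN NDM) (convolution_trig _ hT DN NDM).
pose dT n := fejer_mean n M T (x + h) - fejer_mean n M T x.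
pose E := 6 * (H * h `^ (al * 2)) + 3 * e.
have E0 : 0 <= E by rewrite addr_ge0 ?mulr_ge0 ?powR_ge0.
pose p n : R := n.+1%:R `^ al.
have p1 n : 1 <= p n.
  have : 1 `^ al <= p n by rewrite ge0_ler_powR ?nnegrE ?(ltW al0)// ler1n.
  by rewrite powR1.
have dTE n : (n <= N)%N -> `|dT n| <= E * p n.
  move=> nN; apply: (@le_trans _ _ (6 * (H * h `^ (al * 2)) * p n + 3 * e)).
    by apply: (fejer_mean_holder x hT) => //; rewrite (leq_trans _ NDM)// leq_add2r.
  by rewrite /E [leRHS]mulrDl lerD2l ler_peMr ?mulr_ge0.
pose b n : R := Num.sqrt n.+1%:R.
have b1 n : 1 <= b n by rewrite -[leLHS]sqrtr1 ler_sqrt// ler1n.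
have b0 n : 0 < b n by rewrite (lt_le_trans _ (b1 n)).
have b2 n : n.+1%:R = b n ^+ 2 by rewrite sqr_sqrtr.
have bE n : b n = n.+1%:R `^ 2^-1 by rewrite powR12_sqrt.
have pb n : p n <= b n by rewrite bE ler_powR ?ler1n//; lra.
have pE n : p n / b n ^+ 3 = n.+1%:R `^ (- (1 + ep)).
  rewrite bE -powR_mulrn ?powR_ge0// -powRrM -powRN -powRD.
    by congr (_ `^ _); rewrite /ep; field.
  by rewrite pnatr_eq0 implybT.
have -> : \sum_(n < N) n.+1%:R * (m n - 2 * m n.+1 + m n.+2) *
      fejer_mean n M T (x + h) +
    N.+1%:R * (m N - m N.+1) * fejer_mean N M T (x + h) + m N.+1 * T (x + h) -
    (\sum_(n < N) n.+1%:R * (m n - 2 * m n.+1 + m n.+2) * fejer_mean n M T x +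
    N.+1%:R * (m N - m N.+1) * fejer_mean N M T x + m N.+1 * T x) =
    \sum_(n < N) n.+1%:R * (m n - 2 * m n.+1 + m n.+2) * dT n +
    N.+1%:R * (m N - m N.+1) * dT N + m N.+1 * (T (x + h) - T x).
  under [in RHS]eq_bigr do rewrite /dT mulrBr.
  by rewrite sumrB /dT; ring.
have S1 : `|\sum_(n < N) n.+1%:R * (m n - 2 * m n.+1 + m n.+2) * dT n| <=
    c2 * E * Z.
  apply: (le_trans (ler_norm_sum _ _ _)).
  apply: (@le_trans _ _ (\sum_(n < N) c2 * E * n.+1%:R `^ (- (1 + ep)))).
    apply: ler_sum => n _; rewrite !normrM -pE ger0_norm//.
    apply: (@le_trans _ _ (n.+1%:R * (c2 / b n ^+ 5) * (E * p n))).
      rewrite ler_pM ?mulr_ge0 ?dTE ?ler_wpM2l ?d2//.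
      exact/ltnW/ltn_ord.
    rewrite le_eqVlt; apply/orP; left; apply/eqP; rewrite b2; field.
    by rewrite gt_eqF.
  by rewrite -big_distrr/= ler_wpM2l ?mulr_ge0// sum_powR_le.
have S2 : `|N.+1%:R * (m N - m N.+1) * dT N| <= c1 * E.
  rewrite !normrM ger0_norm//.
  apply: (@le_trans _ _ (N.+1%:R * (c1 / b N ^+ 3) * (E * b N))).
    rewrite ler_pM ?mulr_ge0 ?ler_wpM2l ?d1//.
    by rewrite (le_trans (dTE N _))// ler_wpM2l.
  rewrite le_eqVlt; apply/orP; left; apply/eqP; rewrite b2; field.
  by rewrite gt_eqF.
have S3 : `|m N.+1 * (T (x + h) - T x)| <= H * h `^ (al * 2) + e.
  have hal0 : 0 < h `^ al by rewrite powR_gt0.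
  have bN : (b N)^-1 <= h `^ al.
    rewrite -[leRHS]invrK lef_pV2 ?posrE ?invr_gt0//.
    rewrite -(@ler_pXn2r _ 2) ?nnegrE ?invr_ge0 ?(ltW (b0 N)) ?(ltW hal0)//.
    by rewrite -b2 exprVn.
  rewrite normrM.
  apply: (@le_trans _ _ ((b N)^-1 * (H * h `^ al + e))).
    rewrite ler_pM ?symbol_decay// (le_trans (TH _ _))// addrAC subrr add0r.
    by rewrite [`|h|]gtr0_norm.
  rewrite mulrDr lerD//; last by rewrite ler_piMl// invf_le1.
  apply: (@le_trans _ _ (h `^ al * (H * h `^ al))).
    by rewrite ler_wpM2r// mulr_ge0// powR_ge0.
  by rewrite mulrCA powRrM powR_mulrn ?powR_ge0.
apply: (le_trans (ler_normD _ _)).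
apply: (le_trans (lerD (ler_normD _ _) S3)).
apply: (le_trans (lerD (lerD S1 S2) (lexx _))).
have hh0 : 0 <= H * h `^ (al * 2) by rewrite mulr_ge0 ?powR_ge0.
rewrite /E; move: hh0; set hh := H * _ => hh0.
rewrite [c2 * _ * Z]mulrAC -mulrDl -subr_ge0.
rewrite (_ : _ - _ = (c2 * Z + c1) * (3 * e)); last by ring.
by rewrite !mulr_ge0.
Qed.

(** The smoothing property of the Whitham operator.  Only the supremum norm of
    [f - T] enters, so it survives the passage from polynomials [T] to [f]. *)
Lemma convolution_holder al : 0 < al < 1 / 2 ->
  exists2 C, 0 <= C & forall f H, periodic f (pi *+ 2) ->
    (forall x y, `|f x - f y| <= H * `|x - y| `^ al) ->
    forall x y, `|convolution K f x - convolution K f y| <=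
      C * H * `|x - y| `^ (al * 2).
Proof.
move=> hal; have [C C0 CT] := convolution_trig_holder hal.
have /andP[al0 _] := hal.
exists C => // f H pf fH x y.
have H0 := holder_cst_ge0 fH.
wlog xy : x y / y < x => [hwlog|].
  case: (ltgtP x y) => [xy|xy|->].
  - by rewrite distrC [`|x - y|]distrC hwlog.
  - exact: hwlog.
  - by rewrite subrr normr0 !mulr_ge0 ?powR_ge0.
pose h := x - y; have h0 : 0 < h by rewrite subr_gt0.
have -> : x = y + h by rewrite /h addrC subrK.
rewrite addrAC subrr add0r [`|h|]gtr0_norm//.
have cf := holder_continuous al0 H0 fH.
have fB := holder_periodic_bounded (ltW al0) H0 pf fH.
set B := `|f 0| + _ in fB.
have uc e' : 0 < e' -> exists2 d, 0 < d &
    forall x y, `|x - y| < d -> `|f x - f y| <= e'.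
  by move=> e'0; exact: holder_modulus al0 e'0 H0 fH.
apply/ler_addgt0Pr => e e0.
pose k := C * 2 + L1norm K * 2 + 1.
have k0 : 0 < k by rewrite ltr_wpDl ?addr_ge0 ?mulr_ge0 ?L1norm_ge0.
pose t := e / k; have t0 : 0 < t by rewrite divr_gt0.
have [D [T [hT Tf]]] := trig_poly_dense pf fB uc t0.
have TH u v : `|T u - T v| <= H * `|u - v| `^ al + 2 * t.
  have -> : T u - T v = (f u - f v) + ((T u - f u) - (T v - f v)) by ring.
  rewrite (le_trans (ler_normD _ _))// lerD// (le_trans (ler_normB _ _))//.
  by rewrite mulr_natl mulr2n lerD.
have [BT TB] := trig_poly_bounded hT.
have cT := trig_poly_continuous hT.
have close z : `|convolution K f z - convolution K T z| <= L1norm K * t.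
  by apply: (ler_dist_convolution HK z cf fB cT TB) => u; rewrite distrC.
have t20 : 0 <= 2 * t by rewrite mulr_ge0// ltW.
have main := CT D T H (2 * t) y h hT H0 t20 TH h0.
have -> : convolution K f (y + h) - convolution K f y =
   (convolution K f (y + h) - convolution K T (y + h)) +
   (convolution K T (y + h) - convolution K T y) -
   (convolution K f y - convolution K T y) by ring.
apply: (le_trans (ler_normB _ _)).
apply: (le_trans (lerD (ler_normD _ _) (lexx _))).
apply: (le_trans (lerD (lerD (close _) main) (close _))).
have -> : e = k * t by rewrite /t mulrC divfK// gt_eqF.
rewrite /k; have := t0; move: (ltW t0) => _.
set u := h `^ _; nra.
Qed.

End Smoothing.

(** * Extraction of a uniformly convergent subsequence *)

Section Compactness.
Set Implicit Arguments. Unset Strict Implicit. Unset Printing Implicit Defensive.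
Context {R : realType}.
Implicit Types (u : nat -> R) (f : R -> R).

(** Along an ultrafilter a bounded sequence converges without extraction, which
    makes a diagonal argument over the points of the circle unnecessary. *)
Lemma ultra_bounded_cvg (U : set_system nat) u (A : R) : UltraFilter U ->
  (forall n, `|u n| <= A) ->
  exists l, forall e : R, 0 < e -> U [set n | `|u n - l| < e].
Proof.
move=> UU uA.
have PU : ProperFilter U by exact: ultra_proper.
have UA : (u @ U) [set` `[- A, A]].
  by apply: (@filterE _ U) => n /=; rewrite in_itv/= -ler_norml uA.
have [l [_ cl]] := @segment_compact R (- A) A _ (fmap_proper_filter u PU) UA.
exists l => e e0.
have [//|Uc] := in_ultra_setVsetC [set n | `|u n - l| < e] UU.
have Bl : nbhs l (ball l e) by exact: nbhsx_ballx.
have Uc' : (u @ U) (~` ball l e).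
  by apply: (@filterS _ U _ _ _ _ Uc) => n /= h; rewrite /ball/= distrC.
by have [x [xc xl]] := cl _ _ Uc' Bl.
Qed.

(** Limits are first taken pointwise along an ultrafilter.  The common Hölder
    bound turns convergence on a finite grid into uniform convergence along the
    ultrafilter, whose sets are infinite and so contain the terms of an
    increasing sequence of indices. *)
Lemma uniform_subsequence (mu_ : nat -> R) (phi_ : nat -> R -> R)
    (A B H al : R) : 0 < al -> 0 <= H ->
  (forall n, `|mu_ n| <= A) ->
  (forall n, periodic (phi_ n) (pi *+ 2)) ->
  (forall n x, `|phi_ n x| <= B) ->
  (forall n x y, `|phi_ n x - phi_ n y| <= H * `|x - y| `^ al) ->
  exists (s : nat -> nat) (mu : R) (phi : R -> R),
    [/\ {homo s : m n / (m < n)%N},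
        forall n, `|mu_ (s n) - mu| <= n.+1%:R^-1 &
        forall n x, `|phi_ (s n) x - phi x| <= n.+1%:R^-1].
Proof.
move=> al0 H0 muA pphi phiB phiH.
have [U [UU sU]] := ultraFilterLemma (eventually_filter : ProperFilter \oo).
have PU : ProperFilter U by exact: ultra_proper.
have [mu hmu] := ultra_bounded_cvg UU muA.
have [phi hphi] := choice (fun x => ultra_bounded_cvg UU (phiB ^~ x)).
have phi_close x y : `|phi x - phi y| <= H * `|x - y| `^ al.
  apply/ler_addgt0Pr => e e0; have e2 : 0 < e / 2 by rewrite divr_gt0.
  have [n /= [hx hy]] := filter_ex (filterI (hphi x _ e2) (hphi y _ e2)).
  have := phiH n x y; move: hx hy.
  rewrite !ltr_norml !ler_norml => /andP[? ?] /andP[? ?] /andP[? ?].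
  by apply/andP; split; lra.
have phi_per : periodic phi (pi *+ 2).
  move=> x; apply/eqP; rewrite -subr_eq0 -normr_le0.
  apply/ler_addgt0Pr => e e0; have e2 : 0 < e / 2 by rewrite divr_gt0.
  have [n /= [hx hy]] :=
    filter_ex (filterI (hphi x _ e2) (hphi (x + pi *+ 2) _ e2)).
  move: hx hy; rewrite (pphi n) !ltr_norml !ler_norml => /andP[? ?] /andP[? ?].
  by apply/andP; split; lra.
have unif e : 0 < e -> U [set n | forall x, `|phi_ n x - phi x| <= e].
  move=> e0; have e3 : 0 < e / 3 by rewrite divr_gt0.
  have [d d0 dP] := powR_small al0 e3 H0.
  have grid p : U [set n | forall i, (i < p)%N ->
      `|phi_ n (i%:R * (d / 2)) - phi (i%:R * (d / 2))| < e / 3].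
    elim: p => [|p IHp]; first by apply: filterE => n i.
    apply: filterS (filterI IHp (hphi (p%:R * (d / 2)) _ e3)) => n [/= h1 h2] i.
    by rewrite ltnS leq_eqVlt => /predU1P[->//|]; exact: h1.
  have d20 : 0 < d / 2 by rewrite divr_gt0.
  pose p := (Num.truncn (pi *+ 2 / (d / 2))).+1.
  apply: filterS (grid p) => n /= hn x.
  have [z zpi fz] := circle_representative pi x.
  rewrite -(fz _ (pphi n)) -(fz _ phi_per).
  move: zpi; rewrite ler_norml => /andP[z1 z2].
  have z0 : 0 <= z by lra.
  have zd0 : 0 <= z / (d / 2) by rewrite divr_ge0// ltW.
  pose i := Num.truncn (z / (d / 2)).
  have ip : (i < p)%N.
    rewrite ltnS; apply: le_truncn; rewrite ler_pM2r ?invr_gt0// mulr2n.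
    by lra.
  have /andP[i1 i2] := truncn_itv zd0; rewrite -/i in i1 i2.
  move: i1 i2; rewrite ler_pdivlMr// ltr_pdivrMr// -[i.+1%:R]natr1 mulrDl mul1r => i1 i2.
  set g := i%:R * (d / 2) in i1 i2.
  have zg : `|z - g| < d by rewrite ltr_norml; apply/andP; split; lra.
  have h1 := le_trans (phiH n z g) (dP _ (normr_ge0 _) zg).
  have h2 := le_trans (phi_close z g) (dP _ (normr_ge0 _) zg).
  have h3 := hn i ip; rewrite -/g in h3.
  move: h1 h2 h3; rewrite !ltr_norml !ler_norml.
  by move=> /andP[? ?] /andP[? ?] /andP[? ?]; apply/andP; split; lra.
have next (jk : nat * nat) : exists n, [/\ (jk.2 < n)%N,
    `|mu_ n - mu| <= jk.1.+1%:R^-1 &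
    forall x, `|phi_ n x - phi x| <= jk.1.+1%:R^-1].
  have j0 : 0 < jk.1.+1%:R^-1 :> R by rewrite invr_gt0.
  have gtk : U [set n | (jk.2 < n)%N] by apply: sU; exact: nbhs_infty_gt.
  have [n /= [n1 [n2 n3]]] :=
    filter_ex (filterI gtk (filterI (hmu _ j0) (unif _ j0))).
  by exists n; split => //; exact: ltW.
have [g hg] := choice next.
pose s := fix s j := if j is j'.+1 then g (j, s j') else g (0, 0)%N.
have hs j : `|mu_ (s j) - mu| <= j.+1%:R^-1 /\
    forall x, `|phi_ (s j) x - phi x| <= j.+1%:R^-1.
  by case: j => [|j]; [case: (hg (0, 0)%N)|case: (hg (j.+1, s j))].
exists s, mu, phi; split => [|n|n x].
- apply: homo_ltn; first exact: ltn_trans.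
  by move=> j; case: (hg (j.+1, s j)).
- by case: (hs n).
- by case: (hs n) => _; exact.
Qed.

End Compactness.

(** * Whitham solutions *)

Section Solutions.
Set Implicit Arguments. Unset Strict Implicit. Unset Printing Implicit Defensive.
Context {R : realType}.

(** If [B] is the least bound, then [B^2 <= c B].  The a priori bound [B0] enters
    only qualitatively: it makes [B] finite and does not appear in the
    conclusion. *)
Lemma self_improving_bound (S : set R) (c B0 : R) : 0 <= c ->
  (forall t, S t -> 0 <= t <= B0) ->
  (forall B, (forall t, S t -> t <= B) -> forall t, S t -> t ^+ 2 <= c * B) ->
  forall t, S t -> t <= c.
Proof.
move=> c0 SB0 step t St.
have S0 : S !=set0 by exists t.
have Sb : has_sup S by split=> //; exists B0 => r /SB0/andP[].
pose B := sup S.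
have SB r : S r -> r <= B by exact: sup_upper_bound.
have B0' : 0 <= B by have /andP[t0 _] := SB0 t St; rewrite (le_trans t0 (SB t St)).
have Bs : B <= Num.sqrt (c * B).
  apply: ge_sup => // r Sr; have /andP[r0 _] := SB0 r Sr.
  by rewrite -[leLHS](ger0_norm r0) -sqrtr_sqr ler_wsqrtr// (step B).
have BB : B ^+ 2 <= c * B.
  rewrite -[leRHS]sqr_sqrtr ?mulr_ge0// ler_pXn2r ?nnegrE ?sqrtr_ge0//.
rewrite (le_trans (SB t St))//.
have [->//|Bn0] := eqVneq B 0.
have Bp : 0 < B by rewrite lt_neqAle eq_sym Bn0.
by rewrite -(ler_pM2r Bp) -expr2.
Qed.

Lemma holder_le_exponent (f : R -> R) (H a b B : R) : 0 <= b <= a -> 0 <= H ->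
  (forall x, `|f x| <= B) ->
  (forall x y, `|f x - f y| <= H * `|x - y| `^ a) ->
  forall x y, `|f x - f y| <= (H + 2 * B) * `|x - y| `^ b.
Proof.
move=> /andP[b0 ba] H0 fB fH x y.
have B0 : 0 <= B by rewrite (le_trans _ (fB 0)).
have [->|xy] := eqVneq x y.
  by rewrite subrr normr0 mulr_ge0 ?powR_ge0 ?addr_ge0 ?mulr_ge0.
have r0 : 0 < `|x - y| by rewrite normr_gt0 subr_eq0.
have [r1|r1] := leP `|x - y| 1.
  rewrite (le_trans (fH x y))// ler_pM ?powR_ge0//.
    by rewrite lerDl mulr_ge0.
  by rewrite ger_powR// r0.
apply: (@le_trans _ _ (2 * B)).
  by rewrite (le_trans (ler_normB _ _))// mulr_natl mulr2n lerD.
apply: (@le_trans _ _ (H + 2 * B)); first by rewrite lerDr.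
rewrite ler_peMr ?addr_ge0 ?mulr_ge0//.
have : 1 `^ b <= `|x - y| `^ b by rewrite ge0_ler_powR ?nnegrE// ltW.
by rewrite powR1.
Qed.

Context (K : R -> R) (HK : is_whitham_kernel K).

Lemma whitham_eq_square (mu : R) (phi : R -> R) x : whitham_eq K mu phi ->
  (mu / 2 - phi x) ^+ 2 = mu ^+ 2 / 4 - convolution K phi x.
Proof.
by move=> /(_ x) E; lra.
Qed.

(** From [phi^2 = mu phi - K * phi] and [mu < 1], a bound [B] of [|phi|] improves
    to the square root of [(1 + L1norm K) B]. *)
Lemma whitham_solution_bounded alpha0 (phi : R -> R) (mu : R) : 0 < alpha0 ->
  whitham_solutions K alpha0 (phi, mu) -> forall x, `|phi x| <= 1 + L1norm K.
Proof.
move=> a0 [[[/= pphi [H phiH]] _] /andP[mu0 mu1] _ eqphi].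
have fH x y := phiH x y I I.
have H0 := holder_cst_ge0 fH.
have cphi := holder_continuous a0 H0 fH.
have phiB := holder_periodic_bounded (ltW a0) H0 pphi fH.
have K0 := L1norm_ge0 K.
move=> x; apply: (@self_improving_bound [set `|phi y| | y in setT] _
  (`|phi 0| + H * pi `^ alpha0)); last by exists x.
- by rewrite addr_ge0.
- by move=> _ [y _ <-]; rewrite normr_ge0 phiB.
move=> B hB _ [y _ <-].
have phiB' z : `|phi z| <= B by apply: hB; exists z.
have B0 : 0 <= B by rewrite (le_trans _ (phiB' 0)).
rewrite real_normK ?num_real//.
have -> : phi y ^+ 2 = mu * phi y - convolution K phi y.
  by apply/eqP; rewrite -subr_eq0 -[X in _ == X](eqphi y); apply/eqP; ring.
rewrite mulrDl mul1r lerD//.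
  rewrite (le_trans (ler_norm _))// normrM gtr0_norm//.
  by rewrite (le_trans (ler_wpM2l (ltW mu0) (phiB' y)))// ler_piMl// ltW.
by rewrite (le_trans (ler_norm _))// normrN ler_norm_convolution.
Qed.

Lemma ler_sqr_dist (a b : R) : 0 <= a -> 0 <= b ->
  `|a - b| ^+ 2 <= `|a ^+ 2 - b ^+ 2|.
Proof.
move=> a0 b0; rewrite subr_sqr normrM expr2 ler_wpM2l//.
by rewrite (le_trans (ler_normB _ _))// !ger0_norm ?addr_ge0.
Qed.

(** The self-improvement applies to the difference quotients of order [al]: their
    squares are those of [K * phi] of order [2 al], which [convolution_holder]
    bounds linearly.  The exponent [alpha0], being above [al], makes them
    bounded. *)
Lemma whitham_solution_holder al : 0 < al < 1 / 2 ->
  exists2 C, 0 <= C & forall alpha0 (phi : R -> R) (mu : R), 1 / 2 < alpha0 ->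
    whitham_solutions K alpha0 (phi, mu) ->
    forall x y, `|phi x - phi y| <= C * `|x - y| `^ al.
Proof.
move=> hal; have [C C0 convH] := convolution_holder HK hal.
have /andP[al0 al2] := hal.
exists C => // alpha0 phi mu ha0 Sphi.
have a0 : 0 < alpha0 by lra.
have phiB := whitham_solution_bounded a0 Sphi.
move: (Sphi) => [[[/= pphi [H phiH]] _] _ phimu eqphi].
have fH x y := phiH x y I I.
have H0 := holder_cst_ge0 fH.
have baal : 0 <= al <= alpha0 by lra.
have fH' := holder_le_exponent baal H0 phiB fH.
pose S := [set t | exists x y, x != y /\ t = `|phi x - phi y| / `|x - y| `^ al].
have pw (x y : R) : x != y -> 0 < `|x - y| `^ al.
  by move=> xy; rewrite powR_gt0// normr_gt0 subr_eq0.
have bound : forall t, S t -> t <= C.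
  apply: (@self_improving_bound S C (H + 2 * (1 + L1norm K))) => //.
    move=> _ [x [y [xy ->]]]; rewrite divr_ge0 ?powR_ge0//=.
    by rewrite ler_pdivrMr ?pw.
  move=> B SB _ [x [y [xy ->]]].
  have hB u v : `|phi u - phi v| <= B * `|u - v| `^ al.
    have [->|uv] := eqVneq u v.
      by rewrite !subrr normr0 powR0 ?mulr0// gt_eqF.
    by rewrite -ler_pdivrMr ?pw//; apply: SB; exists u, v.
  rewrite expr_div_n ler_pdivrMr ?exprn_gt0 ?pw//.
  have -> : (`|x - y| `^ al) ^+ 2 = `|x - y| `^ (al * 2).
    by rewrite powRrM powR_mulrn// powR_ge0.
  apply: le_trans (convH phi B pphi hB x y).
  have -> : `|phi x - phi y| = `|(mu / 2 - phi x) - (mu / 2 - phi y)|.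
    by rewrite distrC; congr `| _ |; ring.
  rewrite (le_trans (ler_sqr_dist _ _))// ?subr_ge0 ?(ltW (phimu _))//.
  rewrite !(whitham_eq_square _ eqphi) distrC.
  by rewrite le_eqVlt; apply/orP; left; apply/eqP; congr `| _ |; ring.
move=> x y; have [->|xy] := eqVneq x y.
  by rewrite !subrr normr0 mulr_ge0 ?powR_ge0.
by rewrite -ler_pdivrMr ?pw//; apply: bound; exists x, y.
Qed.

End Solutions.

Theorem theorem4p8 (R : realType) (K : R -> R) (HK : is_whitham_kernel K)
    (alpha0 : R) (Halpha0 : 1 / 2 < alpha0 < 1)
    (phi_ : nat -> R -> R) (mu_ : nat -> R)
    (HS : forall n, whitham_solutions K alpha0 (phi_ n, mu_ n)) :
  exists (s : nat -> nat) (mu : R) (phi : R -> R),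
    [/\ {homo s : m n / (m < n)%N},
        mu_ (s n) @[n --> \oo] --> mu,
        {uniform, phi_ (s n) @[n --> \oo] --> phi} &
        [/\ whitham_eq K mu phi,
            forall alpha : R, 0 < alpha < 1 / 2 -> C_circle alpha phi &
            forall x : R, phi x < mu / 2 ->
              forall alpha : R, 0 < alpha < 1 -> holder_near alpha phi x]].
Proof.
have /andP[ha0 _] := Halpha0.
have a00 : 0 < alpha0 by lra.
have phiB n := whitham_solution_bounded HK a00 (HS n).
have mu1 n : `|mu_ n| <= 1.
  by have [_ /= /andP[? ?] _ _] := HS n; rewrite ler_norml; apply/andP; split; lra.
have pphi n : periodic (phi_ n) (pi *+ 2) by have [[[]]] := HS n.
have q14 : 0 < (1 / 4 : R) < 1 / 2 by lra.
have /andP[q0 _] := q14.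
have [C0 C00 phiC0] := whitham_solution_holder HK q14.
have phiC0' n := phiC0 _ _ _ ha0 (HS n).
have [s [mu [phi [homos hmu hphi]]]] :=
  uniform_subsequence q0 C00 mu1 pphi phiB phiC0'.
have inv_small (e : R) : 0 < e -> exists n : nat, n.+1%:R^-1 <= e.
  move=> e0; exists (Num.truncn e^-1).
  by rewrite invf_ple ?posrE//; exact/ltW/truncnS_gt.
have phi_holder al : 0 < al < 1 / 2 -> exists2 C, 0 <= C &
    forall x y, `|phi x - phi y| <= C * `|x - y| `^ al.
  move=> hal; have [C C_ge0 phiC] := whitham_solution_holder HK hal.
  exists C => // x y; apply/ler_addgt0Pr => e e0.
  have [|n hn] := inv_small (e / 2); first by rewrite divr_gt0.
  have := phiC _ _ _ ha0 (HS (s n)) x y; have := le_trans (hphi n x) hn; have := le_trans (hphi n y) hn.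
  rewrite !ler_norml => /andP[? ?] /andP[? ?] /andP[? ?].
  by apply/andP; split; lra.
have phi_per : periodic phi (pi *+ 2).
  move=> x; apply/eqP; rewrite -subr_eq0 -normr_le0.
  apply/ler_addgt0Pr => e e0.
  have [|n hn] := inv_small (e / 2); first by rewrite divr_gt0.
  have := le_trans (hphi n x) hn; have := le_trans (hphi n (x + pi *+ 2)) hn; rewrite (pphi (s n)).
  rewrite !ler_norml => /andP[? ?] /andP[? ?].
  by apply/andP; split; lra.
have [C1 C10 phiC1] := phi_holder _ q14.
have cphi := holder_continuous q0 C10 phiC1.
have phi_bd := holder_periodic_bounded (ltW q0) C10 phi_per phiC1.
have cphi_ n := holder_continuous q0 C00 (phiC0' n).
have cvg_harm (u : nat -> R) (l c : R) :
    (forall n, `|u n - l| <= c * n.+1%:R^-1) -> u n @[n --> \oo] --> l.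
  move=> ul; apply/cvgrPdist_le => e e0.
  have c0 : 0 <= c by have := ul 0%N; rewrite invr1 mulr1; exact: le_trans.
  near=> n; rewrite distrC (le_trans (ul n))// ler_pdivrMr//.
  rewrite mulrC -ler_pdivrMr//.
  have : c / e < n.+1%:R.
    rewrite (lt_le_trans (truncnS_gt _))// ler_nat ltnS; near: n.
    exact: nbhs_infty_ge.
  exact: ltW.
have cmu : mu_ (s n) @[n --> \oo] --> mu.
  by apply: (cvg_harm _ _ 1) => n; rewrite mul1r.
have eqphi : whitham_eq K mu phi.
  move=> x.
  have cx : phi_ (s n) x @[n --> \oo] --> phi x.
    by apply: (cvg_harm _ _ 1) => n; rewrite mul1r.
  have cK : convolution K (phi_ (s n)) x @[n --> \oo] --> convolution K phi x.
    apply: (cvg_harm _ _ (L1norm K)) => n.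
    by apply: (ler_dist_convolution HK x (cphi_ _) (phiB _) cphi phi_bd).
  have lim0 : (- mu_ (s n) * phi_ (s n) x + phi_ (s n) x ^+ 2 +
      convolution K (phi_ (s n)) x) @[n --> \oo] -->
      - mu * phi x + phi x ^+ 2 + convolution K phi x.
    apply: cvgD => //; apply: cvgD; first by apply: cvgM => //; exact: cvgN.
    by rewrite expr2; under eq_fun do rewrite expr2; exact: cvgM.
  apply/esym/(cvg_unique _ _ lim0) => //.
  have -> : (fun n => - mu_ (s n) * phi_ (s n) x + phi_ (s n) x ^+ 2 +
      convolution K (phi_ (s n)) x) = cst 0.
    by apply/funext => n; have [_ _ _ /(_ x)] := HS (s n).
  exact: cvg_cst.
exists s, mu, phi; split => //.
- move=> P /uniform_nbhs[E [entE EP]].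
  move: entE; rewrite -entourage_ballE => -[e /= e0 eE].
  near=> n; apply: EP => y _; apply: eE => /=.
  rewrite /ball/= distrC (le_lt_trans (hphi n y))//.
  rewrite invf_plt ?posrE// (lt_le_trans (truncnS_gt _))// ler_nat ltnS.
  by near: n; exact: nbhs_infty_ge.
split => // [al hal|x hx al hal].
  split => //; have [C _ phiC] := phi_holder _ hal.
  by exists C => y z _ _; exact: phiC.
have hal2 : 0 < al / 2 < 1 / 2 by lra.
have [C C_ge0 phiC] := phi_holder _ hal2.
have [CK CK0 convH] := convolution_holder HK hal2.
have convH' := convH phi C phi_per phiC.
rewrite (_ : al / 2 * 2 = al) in convH'; last by field.
(* On the neighbourhood where [mu / 2 - phi] exceeds [c], the difference of its
   squares at two points controls [c] times the difference of its values. *)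
pose c := (mu / 2 - phi x) / 2.
have c0 : 0 < c by rewrite divr_gt0// subr_gt0.
exists [set y | c < mu / 2 - phi y].
  have cv : mu / 2 - phi y @[y --> x] --> mu / 2 - phi x.
    by apply: cvgB; [exact: cvg_cst|exact: cphi].
  apply: (cvgr_gt _ cv); rewrite /c; lra.
exists (CK * C / c) => y z /= cy cz.
rewrite mulrAC ler_pdivlMr//.
apply: le_trans (convH' y z).
have -> : `|convolution K phi y - convolution K phi z| =
    `|phi y - phi z| * ((mu / 2 - phi y) + (mu / 2 - phi z)).
  rewrite -[X in _ * X]gtr0_norm; last by lra.
  rewrite -normrM; congr `| _ |.
  have := whitham_eq_square y eqphi; have := whitham_eq_square z eqphi.
  by move=> hz hy; lra.
by rewrite ler_wpM2l//; lra.
Unshelve. all: by end_near. Qed.
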